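(* For every $\varepsilon\in(0,1]$ there exist $\delta(\varepsilon)>0$ and $n_0(\varepsilon)$ such that for all $n\ge n_0(\varepsilon)$ the following holds. In the random matching model with $n$ boys and $n$ girls, let $F$ be a set of $\lfloor(1-\varepsilon)n\rfloor$ girls chosen uniformly at random, independently of the preferences. Then the probability that $F$ is not a winning coalition is at least $\delta(\varepsilon)$.
   Context: A stable matching instance consists of a set $B=\{b_1,\dots,b_n\}$ of boys and a set $G=\{g_1,\dots,g_n\}$ of girls, where every boy has a strict preference ranking over all girls and every girl has a strict preference ranking over all boys. A perfect matching $\mu$ between boys and girls is stable if there is no pair $(b,g)$ such that $b$ prefers $g$ to $\mu(b)$ and $g$ prefers $b$ to $\mu(g)$. A stable-partner of a person is anyone matched to that person in some stable matching; the best stable-partner is the most preferred one. The set of stable matchings is a distributive lattice under the order $\mu_1\geqslant\mu_2$ iff every boy weakly prefers his partner in $\mu_1$ to his partner in $\mu_2$. Its minimum element $\mathbf{0}$ is the girl-optimal (boy-pessimal) stable matching, in which every girl is matched to her best stable-partner. For $F\subseteq G$, let $\mathcal{M}_F$ be the set of stable matchings in which every girl in $F$ is matched to her best stable-partner; it is a (nonempty) lattice under $\geqslant$, and $\mathbf{1}_F$ denotes its maximum element. $F$ is a winning coalition if $\mathbf{1}_F=\mathbf{0}$. Random matching model: the preference rankings of the $n$ boys and $n$ girls are independent, each a uniformly random permutation of the members of the other side. *)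

(* Defs.v *)
From mathcomp Require Import all_boot all_order all_fingroup all_algebra.
From mathcomp Require Import reals.

Set Implicit Arguments.
Unset Strict Implicit.
Unset Printing Implicit Defensive.

Import GRing.Theory Num.Theory.

Local Open Scope ring_scope.

(* Boys and girls are both indexed by 'I_n.  A strict ranking of the other
   side is a permutation r : {perm 'I_n}, where r x is the rank of x and rank 0
   is the most preferred. *)
Definition rankings (n : nat) := {ffun 'I_n -> {perm 'I_n}}.

Section StableMatching.

Variables (n : nat) (bpref gpref : rankings n).

Definition prefers (r : {perm 'I_n}) (x y : 'I_n) : bool := (r x < r y)%N.

Definition weakly_prefers (r : {perm 'I_n}) (x y : 'I_n) : bool :=
  (r x <= r y)%N.

(* A perfect matching is a permutation mu: boy b is matched to girl mu b, and
   girl g to boy mu^-1 g. *)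
Definition stable (mu : {perm 'I_n}) : bool :=
  ~~ [exists b : 'I_n, exists g : 'I_n,
        prefers (bpref b) g (mu b) && prefers (gpref g) b ((mu^-1)%g g)].

Definition stable_matchings : {set {perm 'I_n}} := [set mu | stable mu].

Definition stable_partner_of_girl (g b : 'I_n) : bool :=
  [exists mu in stable_matchings, (mu^-1)%g g == b].

Definition best_stable_partner_of_girl (g b : 'I_n) : bool :=
  stable_partner_of_girl g b &&
  [forall b' : 'I_n,
     stable_partner_of_girl g b' ==> weakly_prefers (gpref g) b b'].

Definition matching_ge (mu1 mu2 : {perm 'I_n}) : bool :=
  [forall b : 'I_n, weakly_prefers (bpref b) (mu1 b) (mu2 b)].

Definition is_maximum (S : {set {perm 'I_n}}) (mu : {perm 'I_n}) : bool :=
  (mu \in S) && [forall nu in S, matching_ge mu nu].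

Definition is_minimum (S : {set {perm 'I_n}}) (mu : {perm 'I_n}) : bool :=
  (mu \in S) && [forall nu in S, matching_ge nu mu].

Definition best_for (F : {set 'I_n}) : {set {perm 'I_n}} :=
  [set mu in stable_matchings |
     [forall g in F, best_stable_partner_of_girl g ((mu^-1)%g g)]].

(* matching_ge is antisymmetric, so a maximum (minimum) is unique: this says
   that the maximum of best_for F equals the minimum of stable_matchings. *)
Definition winning_coalition (F : {set 'I_n}) : bool :=
  [exists mu, is_maximum (best_for F) mu && is_minimum stable_matchings mu].

End StableMatching.

Section RandomModel.

Variable R : realType.

Definition unif (T : finType) (x : T) : R := #|T|%:R^-1.

Definition coalition (n k : nat) : finType := {F : {set 'I_n} | #|F| == k}.

(* Rankings of the boys, rankings of the girls, and a set of k girls. *)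
Definition outcome (n k : nat) : finType :=
  (rankings n * rankings n * coalition n k)%type.

(* The joint law is the product of the uniform laws of its 2n + 1 components,
   which are therefore independent. *)
Definition law (n k : nat) (w : outcome n k) : R :=
  (\prod_(b < n) unif (w.1.1 b)) * (\prod_(g < n) unif (w.1.2 g)) * unif w.2.

Definition Pr (n k : nat) (E : pred (outcome n k)) : R := \sum_(w | E w) law w.

Definition not_winning (n k : nat) (w : outcome n k) : bool :=
  ~~ winning_coalition w.1.1 w.1.2 (val w.2).

End RandomModel.

(* Main.v *)
Require Import Defs.
From mathcomp Require Import all_boot all_order all_fingroup all_algebra.
From mathcomp Require Import reals zify ring lra.

(* Let mu be the girl-optimal stable matching, and continue each girl's list
   below her partner until the first boy who prefers her to his own partner.
   If for two girls g, g' outside F these boys are each other's partners, then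
   swapping the two couples gives another stable matching in which F is still
   optimally matched, so F is not winning.  Since F is independent of the
   preferences and leaves out a positive fraction of the girls, it suffices
   that such a pair (g, g') exists with probability bounded below.
   Condition on the proposals of the girl-proposing algorithm: on each girl's
   list down to her partner, and on the order in which each boy b ranks the
   girls who proposed to him.  The rest is uniform and independent, and mu
   stays girl-optimal.  If k_b girls proposed to b, then b prefers any other
   given girl to his partner with probability w_b = 1 / (k_b + 1).  With
   W = \sum_b w_b, look only at a window of about n / (16 W) boys below each
   girl's partner: the expected number of pairs as above is at least a
   constant, and the second moment method applies, because the events for
   disjoint pairs are independent, while overlapping pairs are excluded by
   requiring that no other boy in the two windows accept.
   This needs W to be much larger than sqrt n.  By the coupon collector
   argument the expected number of proposals is at most n H_n, so that W is
   typically of order at least n / log n. *)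

Set Implicit Arguments.
Unset Strict Implicit.
Unset Printing Implicit Defensive.

Import Order.TTheory GRing.Theory Num.Theory.

(** * Stable matchings: joins, the girl-optimal matching, and the exchange of two couples *)

Section StableLattice.

Variables (n : nat) (bp gp : rankings n).
Implicit Types (mu nu : {perm 'I_n}) (b g : 'I_n).

Lemma stableP mu :
  reflect (forall b g, bp b g < bp b (mu b) -> gp g ((mu^-1)%g g) <= gp g b)
    (stable bp gp mu).
Proof.
apply: (iffP negP) => [st b g lt_b|st].
  rewrite leqNgt; apply/negP => lt_g; apply: st.
  by apply/existsP; exists b; apply/existsP; exists g; apply/andP.
case/existsP=> b /existsP[g /andP[lt_b lt_g]].
by move: (st b g lt_b); rewrite leqNgt; move/negP; apply.
Qed.

Lemma rank_inj (r : {perm 'I_n}) x y : (r x = r y :> nat) -> x = y.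
Proof. by move=> /val_inj /perm_inj. Qed.

Lemma rank_lt (r : {perm 'I_n}) x y : x != y -> (r x < r y) = (r x <= r y).
Proof.
move=> xy; rewrite ltn_neqAle; case: (_ =P _) => //= /rank_inj e.
by rewrite e eqxx in xy.
Qed.

(** Every girl takes the better of her two partners. If a boy were chosen by two girls, [g] from
    [mu] and [g'] from [nu], then whichever of them he prefers would block with him the matching
    that gives him the other one; this is [cross]. A pair blocking the join would block the matching
    from which the boy's couple is taken. *)
Lemma stable_join mu nu : stable bp gp mu -> stable bp gp nu ->
  exists2 la, stable bp gp la &
    forall g, gp g ((la^-1)%g g)
      = minn (gp g ((mu^-1)%g g)) (gp g ((nu^-1)%g g)) :> nat.
Proof.
move=> /stableP smu /stableP snu.
pose better g := gp g ((mu^-1)%g g) <= gp g ((nu^-1)%g g).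
pose f g := if better g then (mu^-1)%g g else (nu^-1)%g g.
have cross g g' : better g -> ~~ better g' ->
    (mu^-1)%g g = (nu^-1)%g g' -> False.
  rewrite /better => bg; rewrite -ltnNge => bg' e.
  set b := (mu^-1)%g g in e bg.
  have eg : mu b = g by rewrite permKV.
  have eg' : nu b = g' by rewrite e permKV.
  have ngg : g != g'.
    by apply/eqP => eg0; move: bg; rewrite /b eg0 leqNgt bg'.
  case: (ltngtP (bp b g) (bp b g')) => [lt|lt|/rank_inj eq]; last by rewrite eq eqxx in ngg.
  - rewrite -eg' in lt; move: (snu _ _ lt) => le.
    have/rank_inj : gp g b = gp g ((nu^-1)%g g) :> nat by lia.
    by move/(congr1 nu); rewrite permKV eg' => eq; rewrite eq eqxx in ngg.
  - rewrite -eg in lt; move: (smu _ _ lt) => le.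
    by rewrite e in le; lia.
have finj : injective f.
  move=> g g'; rewrite /f; case: ifP => h1; case: ifP => h2.
  - by apply: perm_inj.
  - by move=> e; case: (cross g g' h1 (negbT h2) e).
  - by move=> /esym e; case: (cross g' g h2 (negbT h1) e).
  - by apply: perm_inj.
have fE g : (((perm finj)^-1)^-1)%g g = f g by rewrite invgK permE.
exists ((perm finj)^-1)%g; last first.
  by move=> g; rewrite fE /f /better; case: leqP.
apply/stableP => b g; set g' := ((perm finj)^-1)%g b => lt; rewrite fE.
have eb : b = f g' by rewrite -fE /g' permK.
rewrite /f; move: eb; rewrite {1}/f; case: ifP => h1 eb; case: ifP => h2.
- by apply: smu; rewrite eb permKV -eb.
- apply: leq_trans (smu b g _); first by move/negbT: h2; rewrite -ltnNge => /ltnW.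
  by rewrite eb permKV -eb.
- apply: leq_trans h2 (snu b g _); by rewrite eb permKV -eb.
- by apply: snu; rewrite eb permKV -eb.
Qed.

Definition girl_optimal mu :=
  stable bp gp mu /\
  forall nu, stable bp gp nu ->
    forall g, gp g ((mu^-1)%g g) <= gp g ((nu^-1)%g g).

Lemma girl_optimal_unique mu nu :
  girl_optimal mu -> girl_optimal nu -> mu = nu.
Proof.
move=> [smu omu] [snu onu]; apply: invg_inj; apply/permP => g.
by apply: (@rank_inj (gp g)); apply/eqP; rewrite eqn_leq omu ?onu.
Qed.

(** Ranks are counted from 1, so that for the girl-optimal matching this is the number of proposals
    in the girl-proposing algorithm. *)
Definition girl_cost mu := \sum_g (gp g ((mu^-1)%g g)).+1.

(** A stable matching of minimal cost is girl-optimal: if some girl did better elsewhere, the join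
    with that matching would be cheaper. *)
Lemma girl_optimal_exists nu : stable bp gp nu ->
  exists2 mu, girl_optimal mu & girl_cost mu <= girl_cost nu.
Proof.
move=> snu; case: (arg_minnP girl_cost snu) => mu smu min_mu.
exists mu; last exact: min_mu.
split=> // la sla g; case: (stable_join smu sla) => ka ska kaE.
have le_ka x : (gp x ((ka^-1)%g x)).+1 <= (gp x ((mu^-1)%g x)).+1.
  by rewrite ltnS kaE geq_minl.
have := min_mu ka ska; rewrite /girl_cost leqNgt => /negP no.
rewrite leqNgt; apply/negP => lt_la; apply: no.
rewrite (bigD1 g) //= [X in _ < X](bigD1 g) //=.
rewrite -addSn leq_add //; last by apply: leq_sum => x _; exact: le_ka.
by rewrite ltnS kaE gtn_min lt_la orbT.
Qed.

(** If [g] did better in [nu], her partner there, who weakly prefers her to his partner in [mu],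
    would block [mu] with her. *)
Lemma minimum_girl_optimal mu :
  is_minimum bp (stable_matchings bp gp) mu -> girl_optimal mu.
Proof.
rewrite /is_minimum inE => /andP[smu /forallP mmu]; split=> // nu snu g.
have := mmu nu; rewrite inE snu /= => /forallP le.
rewrite leqNgt; apply/negP => lt_g.
set b := (nu^-1)%g g in lt_g.
have nb : nu b = g by rewrite permKV.
have ne : g != mu b.
  by apply/eqP => e; rewrite e permK -e ltnn in lt_g.
have := le b; rewrite /weakly_prefers nb -rank_lt //.
by move/stableP: smu => /[apply]; rewrite leqNgt lt_g.
Qed.

(** The exchange improves [b] and [b'] and leaves the other boys alone, so only [g] or [g'] can take
    part in a blocking pair; the last two hypotheses rule this out, as a former partner prefers his
    new girl. The new matching is still best for [F] and better than [mu] for [b], so [mu] is not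
    the maximum for [F]. *)
Lemma swap_not_winning mu g g' (F : {set 'I_n}) :
    girl_optimal mu -> g != g' -> g \notin F -> g' \notin F ->
    let b := (mu^-1)%g g in let b' := (mu^-1)%g g' in
    bp b g' < bp b g -> bp b' g < bp b' g' ->
    (forall c, gp g c < gp g b' -> bp c (mu c) <= bp c g \/ c = b) ->
    (forall c, gp g' c < gp g' b -> bp c (mu c) <= bp c g' \/ c = b') ->
  ~~ winning_coalition bp gp F.
Proof.
move=> omu ngg gF g'F b b' acc_b acc_b' first_g first_g'.
apply/negP => /existsP[mu0 /andP[max_mu0 /minimum_girl_optimal omu0]].
rewrite (girl_optimal_unique omu0 omu) in max_mu0.
case/andP: max_mu0 => mu_best /forallP mu_max.
pose nu := (mu * tperm g g')%g.
have nuE x : nu x = tperm g g' (mu x) by rewrite permM.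
have nuVE x : (nu^-1)%g x = (mu^-1)%g (tperm g g' x).
  by rewrite invMg tpermV permM.
have mub : mu b = g by rewrite permKV.
have mub' : mu b' = g' by rewrite permKV.
have nbb : b != b' by apply/eqP => e; rewrite -mub e mub' eqxx in ngg.
have le_bp c : bp c (nu c) <= bp c (mu c).
  rewrite nuE; case: tpermP => [e|e|//].
    by rewrite (_ : c = b) ?mub; [exact: ltnW | rewrite /b -e permK].
  by rewrite (_ : c = b') ?mub'; [exact: ltnW | rewrite /b' -e permK].
have snu : stable bp gp nu.
  apply/stableP => c x lt_c; rewrite nuVE.
  have lt_c' : bp c x < bp c (mu c) by exact: leq_trans lt_c (le_bp c).
  case: tpermP => [ex|ex|_ _]; last by case: omu => /stableP smu _; exact: smu.
    rewrite ex in lt_c lt_c' *; rewrite leqNgt; apply/negP => lt_g.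
    have [] := first_g c lt_g; first by rewrite leqNgt lt_c'.
    move=> cb; move: lt_c; rewrite cb nuE mub tpermL => lt.
    by rewrite ltnNge (ltnW lt) in acc_b.
  rewrite ex in lt_c lt_c' *; rewrite leqNgt; apply/negP => lt_g.
  have [] := first_g' c lt_g; first by rewrite leqNgt lt_c'.
  move=> cb; move: lt_c; rewrite cb nuE mub' tpermR => lt.
  by rewrite ltnNge (ltnW lt) in acc_b'.
have nu_best : nu \in best_for bp gp F.
  rewrite inE inE snu /=; apply/forall_inP => x xF.
  move: mu_best; rewrite inE => /andP[_ /forall_inP/(_ x xF)].
  rewrite nuVE tpermD //; apply/eqP => e; first by rewrite -e (negbTE gF) in xF.
  by rewrite -e (negbTE g'F) in xF.
have := mu_max nu; rewrite nu_best /= => /forallP/(_ b).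
by rewrite /weakly_prefers nuE mub tpermL leqNgt acc_b.
Qed.

End StableLattice.

(** * Girl-proposing deferred acceptance and the coupon collector bound on its length *)

Section DeferredAcceptance.

Variables (n : nat) (bp : rankings n) (x0 : 'I_n).
Implicit Types (gp : rankings n) (Q : {set 'I_n * 'I_n}) (b c g : 'I_n).

(** [Q] records the proposals made so far as pairs (girl, boy). No tentative matching is stored,
    since each boy's current choice can be read off from [Q]. *)
Definition held Q g :=
  [exists b, ((g, b) \in Q) &&
     [forall g', ((g', b) \in Q) ==> (bp b g <= bp b g')]].

Definition fresh Q := [set b | [forall g, (g, b) \notin Q]].

(** While some boy is fresh, some girl is not held, by [all_held_no_fresh], so the default [x0] does
    not occur. The choice depends on [Q] alone and not on the girls' rankings, as the exchange
    argument of [state_swap] requires. *)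
Definition proposer Q := odflt x0 [pick g | ~~ held Q g].

Definition target gp Q g := odflt x0
  [pick b | ((g, b) \notin Q) &&
     [forall b', ((g, b') \notin Q) ==> (gp g b <= gp g b')]].

Definition step gp Q :=
  if fresh Q == set0 then Q
  else (proposer Q, target gp Q (proposer Q)) |: Q.

Definition state gp t := iter t (step gp) set0.

Lemma targetP gp Q g : fresh Q != set0 ->
  (g, target gp Q g) \notin Q /\
  forall b, (g, b) \notin Q -> gp g (target gp Q g) <= gp g b.
Proof.
case/set0Pn => b0; rewrite inE => /forallP/(_ g) b0Q.
rewrite /target; case: pickP => [b /andP[bQ /forallP min_b] /=|none].
  by split=> // b' b'Q; have := min_b b'; rewrite b'Q.
case: (@arg_minnP _ b0 (fun b => (g, b) \notin Q)
  (fun b => nat_of_ord (gp g b)) b0Q) => b bQ min_b.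
have /negP[] := negbT (none b); rewrite bQ /=.
by apply/forallP => b'; apply/implyP => /min_b.
Qed.

Lemma target_eq gp Q g b : fresh Q != set0 -> (g, b) \notin Q ->
  (forall b', (g, b') \notin Q -> gp g b <= gp g b') -> target gp Q g = b.
Proof.
move=> fQ bQ min_b; have [tQ min_t] := targetP gp g fQ.
by apply: (@rank_inj _ (gp g)); apply/eqP; rewrite eqn_leq min_t ?min_b.
Qed.

Lemma step_sub gp Q : Q \subset step gp Q.
Proof. by rewrite /step; case: ifP => // _; exact: subsetUr. Qed.

(** The invariants of deferred acceptance: girls go down their lists without gaps, and move past a
    boy only after he has received a better proposal. *)
Definition valid gp Q :=
  (forall g b b', (g, b) \in Q -> gp g b' <= gp g b -> (g, b') \in Q) /\
  (forall g b b', (g, b) \in Q -> (g, b') \in Q -> gp g b < gp g b' ->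
     exists2 g', (g', b) \in Q & bp b g' < bp b g).

(** Sending each girl to a boy who holds her is injective, hence onto. *)
Lemma all_held_no_fresh Q : (forall g, held Q g) -> fresh Q = set0.
Proof.
move=> hQ.
have /fin_all_exists[f fP] : forall g, exists b, ((g, b) \in Q) &&
    [forall g', ((g', b) \in Q) ==> (bp b g <= bp b g')].
  by move=> g; apply/existsP/hQ.
have finj : injective f.
  move=> g g' e; have /andP[gQ /forallP g_min] := fP g.
  have /andP[g'Q /forallP g'_min] := fP g'.
  apply: (@rank_inj _ (bp (f g))); apply/eqP; rewrite eqn_leq.
  have := g_min g'; rewrite e g'Q /= => ->.
  by have := g'_min g; rewrite -e gQ.
apply/setP => b; rewrite !inE; apply/negP => /forallP b_fresh.
have [g eb] : exists g, b = f g.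
  by have [f' _ ff'] := injF_bij finj; exists (f' b); rewrite ff'.
by have := b_fresh g; rewrite eb; case/andP: (fP g) => ->.
Qed.

Lemma proposer_free Q : fresh Q != set0 -> ~~ held Q (proposer Q).
Proof.
rewrite /proposer; case: pickP => //= hQ /eqP[]; apply: all_held_no_fresh => g.
by have /negbFE := hQ g.
Qed.

Lemma valid_step gp Q : valid gp Q -> valid gp (step gp Q).
Proof.
rewrite /step; case: eqP => // /eqP fQ [vpre vrej].
set g0 := proposer Q; set c := target _ _ _.
have [cQ c_min] := targetP gp g0 fQ; rewrite -/c in cQ c_min.
have g0_free := proposer_free fQ; rewrite -/g0 in g0_free.
split=> g b b'; rewrite !in_setU1.
  case/orP => [/eqP[-> ->] le|gbQ le]; last by rewrite (vpre _ _ _ gbQ le) orbT.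
  case: (boolP ((g0, b') \in Q)) => [_|b'Q]; first by rewrite orbT.
  rewrite orbF; apply/eqP; congr pair; apply: (@rank_inj _ (gp g0)).
  by apply/eqP; rewrite eqn_leq le c_min.
case/orP => [/eqP[-> ->]|gbQ].
  case/orP => [/eqP[->]|b'Q lt]; first by rewrite ltnn.
  by rewrite (vpre _ _ _ b'Q (ltnW lt)) in cQ.
case/orP => [/eqP[eg _] lt|b'Q lt].
  move/existsPn: g0_free => /(_ b); rewrite -eg gbQ /= => /forallPn[g'].
  rewrite negb_imply -ltnNge => /andP[g'Q lt']; exists g' => //.
  by rewrite in_setU1 g'Q orbT.
by have [g' g'Q lt'] := vrej _ _ _ gbQ b'Q lt; exists g'; rewrite // in_setU1 g'Q orbT.
Qed.

Lemma valid_state gp t : valid gp (state gp t).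
Proof.
elim: t => [|t IH]; last exact: valid_step.
by split=> g b b'; rewrite inE.
Qed.

Lemma card_prefix (r : {perm 'I_n}) x : #|[set y | r y <= r x]| = (r x).+1.
Proof.
rewrite -(card_imset _ (@perm_inj _ r)).
have -> : r @: [set y | r y <= r x] = [set i : 'I_n | i < (r x).+1].
  apply/setP => i; rewrite inE; apply/imsetP/idP => [[y]|lt].
    by rewrite inE => le ->.
  by exists ((r^-1)%g i); rewrite ?inE permKV.
rewrite -sum1dep_card -(big_ord_widen_cond _ xpredT (fun=> 1)) ?ltn_ord //.
by rewrite sum1_card card_ord.
Qed.

(** Each boy takes his favourite suitor. Two boys cannot take the same girl: she moved past the one
    she prefers, so he has a better suitor. A girl has proposed to everyone she prefers to her
    partner, which gives both stability and the bound on the cost. *)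
Lemma stable_of_final gp Q : valid gp Q -> fresh Q = set0 ->
  exists2 mu, stable bp gp mu & girl_cost gp mu <= #|Q|.
Proof.
move=> [vpre vrej] fQ.
have /fin_all_exists[f fP] : forall b, exists g, (g, b) \in Q /\
    forall g', (g', b) \in Q -> bp b g <= bp b g'.
  move=> b; have : b \notin fresh Q by rewrite fQ inE.
  rewrite inE => /forallPn[g0]; rewrite negbK => g0Q.
  by case: (@arg_minnP _ g0 (fun g => (g, b) \in Q)
    (fun g => nat_of_ord (bp b g)) g0Q) => g gQ g_min; exists g.
have finj : injective f.
  move=> b b' e; have [bQ b_min] := fP b; have [b'Q b'_min] := fP b'.
  case: (ltngtP (gp (f b) b) (gp (f b) b')) => [lt|lt|/rank_inj //].
    rewrite -e in b'Q; have [g gQ] := vrej _ _ _ bQ b'Q lt.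
    by rewrite ltnNge b_min.
  rewrite -e in b'Q; have [g gQ] := vrej _ _ _ b'Q bQ lt.
  by rewrite e ltnNge b'_min.
have fVQ g : (g, ((perm finj)^-1)%g g) \in Q.
  have [+ _] := fP (((perm finj)^-1)%g g).
  by rewrite -[f _](permE finj) permKV.
exists (perm finj).
  apply/stableP => b g; rewrite permE => lt; rewrite leqNgt; apply/negP => lt_g.
  have gQ := vpre _ _ _ (fVQ g) (ltnW lt_g).
  by have [_ /(_ _ gQ)] := fP b; rewrite leqNgt lt.
have -> : #|Q| = \sum_g \sum_(b | (g, b) \in Q) 1.
  by rewrite pair_big_dep -sum1_card; apply: eq_bigl; case.
apply: leq_sum => g _; rewrite sum1dep_card -card_prefix.
by apply: subset_leq_card; apply/subsetP => b; rewrite !inE; exact/vpre/fVQ.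
Qed.

Lemma fresh_sub Q Q' : Q \subset Q' -> fresh Q' \subset fresh Q.
Proof.
move=> /subsetP sub; apply/subsetP => b; rewrite !inE => /forallP nb.
by apply/forallP => g; apply: contra (nb g); exact: sub.
Qed.

(** As long as a boy is fresh, each step adds a new pair, and there are only [n * n] pairs. *)
Lemma state_final gp t : n * n < t -> fresh (state gp t) = set0.
Proof.
move=> lt_t; apply/eqP/negPn/negP => ft.
suff card_t : #|state gp t| = t.
  by have := max_card (mem (state gp t)); rewrite card_t card_prod card_ord; lia.
elim: t ft {lt_t} => [|t IH] ft; first by rewrite cards0.
have ft' : fresh (state gp t) != set0.
  apply: contraNN ft; rewrite -!subset0; apply: subset_trans.
  exact/fresh_sub/step_sub.
rewrite /state iterS -/(state gp t) /step (negbTE ft') cardsU1.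
by have [-> _] := targetP gp (proposer (state gp t)) ft'; rewrite IH.
Qed.

Definition swap_ranks gp g b c : rankings n :=
  [ffun g' => if g' == g then (tperm b c * gp g)%g else gp g'].

Lemma swap_ranksE gp g b c x : swap_ranks gp g b c g x = gp g (tperm b c x).
Proof. by rewrite ffunE eqxx permM. Qed.

Lemma swap_ranksC gp g b c : swap_ranks gp g b c = swap_ranks gp g c b.
Proof. by rewrite /swap_ranks tpermC. Qed.

Lemma swap_ranksK gp g b c : swap_ranks (swap_ranks gp g b c) g b c = gp.
Proof.
apply/ffunP => g'; rewrite ffunE; case: eqP => [->|ne].
  by apply/permP => x; rewrite permM swap_ranksE tpermK.
by rewrite ffunE; case: eqP ne.
Qed.

(* Deferred decisions: the entries of g's list that are not yet revealed after
   t steps can be exchanged without changing these steps. *)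
Lemma state_swap gp g b c t :
    (g, b) \notin state gp t -> (g, c) \notin state gp t ->
  state (swap_ranks gp g b c) t = state gp t.
Proof.
elim: t => [//|t IH]; rewrite /state !iterS -!/(state _ t) => nb nc.
have sub := subsetP (step_sub gp (state gp t)).
have nb' : (g, b) \notin state gp t by apply: contra nb; exact: sub.
have nc' : (g, c) \notin state gp t by apply: contra nc; exact: sub.
rewrite IH //; move: (state gp t) nb nc nb' nc' {sub IH} => Q.
rewrite /step; case: eqP => // /eqP fQ; set g0 := proposer Q.
rewrite !in_setU1 !negb_or => /andP[nb _] /andP[nc _] nb' nc'.
congr (_ |: _); congr pair; case: (g0 =P g) => [eg|ne]; last first.
  by rewrite /target ffunE; case: eqP ne.
rewrite eg in nb nc *; have [dQ d_min] := targetP gp g fQ.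
have swK x : (g, x) \notin Q -> (g, tperm b c x) \notin Q by case: tpermP => [->|->|].
apply: target_eq => // x xQ; rewrite !swap_ranksE.
rewrite tpermD; first by apply/d_min/swK.
  by apply: contra nb => /eqP <-.
by apply: contra nc => /eqP <-.
Qed.

Section Potential.

Variable R : realFieldType.
Local Open Scope ring_scope.

Definition harmonic_sum (j : nat) : R := \sum_(i < j) (i.+1%:R)^-1.

(** The proposals made so far plus the coupon collector estimate for those to come. Summed over all
    girls' rankings it does not increase. *)
Definition potential Q : R := #|Q|%:R + n%:R * harmonic_sum #|fresh Q|.

Let target_at gp t := target gp (state gp t) (proposer (state gp t)).

Lemma potential_step gp t : fresh (state gp t) != set0 ->
  potential (state gp t.+1) = potential (state gp t) + 1
    - n%:R * ((target_at gp t \in fresh (state gp t))%:R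
              / #|fresh (state gp t)|%:R).
Proof.
move=> ft; rewrite {1}/state iterS -/(state gp t) /step (negbTE ft) -/(target_at gp t).
have [tQ _] := targetP gp (proposer (state gp t)) ft.
rewrite -/(target_at gp t) in tQ.
move: (state gp t) (target_at gp t) ft tQ => Q d ft tQ.
have fE : fresh ((proposer Q, d) |: Q) = fresh Q :\ d.
  apply/setP => b; rewrite !inE; apply/forallP/andP => [nb|[nbd /forallP nb] g].
    split; last by apply/forallP => g; have := nb g; rewrite in_setU1 negb_or => /andP[].
    by have := nb (proposer Q); rewrite in_setU1 negb_or xpair_eqE eqxx => /andP[].
  by rewrite in_setU1 negb_or nb andbT xpair_eqE negb_and nbd orbT.
rewrite /potential fE cardsU1 tQ natrD (cardsD1 d (fresh Q)).
case: (d \in fresh Q) => /=; last by rewrite !add0n mul0r mulr0; ring.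
rewrite add1n /harmonic_sum big_ord_recr /= mul1r; ring.
Qed.

(* Revealing one more entry of a list: each unrevealed boy is equally likely,
   so the next proposal hits a fresh boy with probability at least
   #|fresh| / n. *)
Lemma fresh_hit_sum t :
  \sum_(gp | fresh (state gp t) != set0) (1 : R) <=
  \sum_(gp | fresh (state gp t) != set0)
     n%:R * ((target_at gp t \in fresh (state gp t))%:R
             / #|fresh (state gp t)|%:R).
Proof.
pose act gp := fresh (state gp t) != set0.
pose J gp : R := #|fresh (state gp t)|%:R.
pose p gp := proposer (state gp t).
pose P (w : rankings n * 'I_n) := act w.1 && ((p w.1, w.2) \notin state w.1 t).
(* An involution on rankings with a marked unrevealed boy: exchanging this boy with the next target
   on the proposer's list also exchanges their roles. *)
pose Phi (w : rankings n * 'I_n) :=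
  (swap_ranks w.1 (p w.1) w.2 (target_at w.1 t), target_at w.1 t).
have PhiP w : P w -> [/\ state (Phi w).1 t = state w.1 t, P (Phi w),
    Phi (Phi w) = w & target_at (Phi w).1 t = w.2].
  case: w => gp b /andP[/= a nb].
  have [tQ t_min] := targetP gp (p gp) a.
  rewrite -/(target_at gp t) in tQ t_min.
  have st : state (Phi (gp, b)).1 t = state gp t by apply: state_swap.
  have tg : target_at (Phi (gp, b)).1 t = b.
    rewrite /target_at st; apply: target_eq => // x xQ.
    rewrite !swap_ranksE tpermL; apply: t_min.
    by case: tpermP => // ->.
  split=> //; first by rewrite /P /act /p st; apply/andP.
  by rewrite {1}/Phi tg /p st /= swap_ranksC swap_ranksK.
(* Every fresh boy is unrevealed, so for each [gp] the terms with a fresh boy add up to 1. *)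
have -> : \sum_(gp | act gp) (1 : R) =
    \sum_(w | P w) (w.2 \in fresh (state w.1 t))%:R / J w.1.
  rewrite -(pair_big_dep act (fun gp b => (p gp, b) \notin state gp t)
     (fun gp b => (b \in fresh (state gp t))%:R / J gp)) /=.
  apply: eq_bigr => gp a; rewrite -mulr_suml.
  rewrite (bigID (mem (fresh (state gp t)))) /= [X in _ + X]big1 ?addr0; last first.
    by move=> b /andP[_ /negbTE ->].
  rewrite (eq_bigl (mem (fresh (state gp t)))); last first.
    move=> b /=; rewrite andbC; case: (boolP (b \in _)) => //=.
    by rewrite inE => /forallP ->.
  rewrite (eq_bigr (fun=> 1)); last by move=> b /= ->.
  rewrite sumr_const mulfV //; rewrite pnatr_eq0 cards_eq0; exact: a.
have -> : \sum_(w | P w) (w.2 \in fresh (state w.1 t))%:R / J w.1 =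
    \sum_(w | P w) (target_at w.1 t \in fresh (state w.1 t))%:R / J w.1.
  rewrite (reindex_onto Phi Phi) /=; last by move=> w /PhiP[].
  apply: eq_big => [w|w].
    apply/andP/idP => [[Pw /eqP <-]|Pw]; first by case: (PhiP _ Pw).
    by have [_ -> -> _] := PhiP _ Pw.
  case/andP=> Pw /eqP e; have [_ Pw' _ _] := PhiP _ Pw; rewrite e in Pw'.
  by have [st _ _ _] := PhiP _ Pw'; rewrite /J st.
rewrite -(pair_big_dep act (fun gp b => (p gp, b) \notin state gp t)
   (fun gp b => (target_at gp t \in fresh (state gp t))%:R / J gp)) /=.
(* At most [n] boys are unrevealed on the proposer's list. *)
apply: ler_sum => gp a; rewrite sumr_const -[leLHS]mulr_natl.
apply: ler_wpM2r; first by rewrite divr_ge0 ?ler0n.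
by rewrite ler_nat -[leqRHS]card_ord max_card.
Qed.

Lemma potential_sum_le t :
  \sum_gp potential (state gp t) <= \sum_(gp : rankings n) potential set0.
Proof.
elim: t => [//|t]; apply: le_trans.
rewrite (bigID (fun gp => fresh (state gp t) == set0)) /=.
rewrite [leRHS](bigID (fun gp => fresh (state gp t) == set0)) /=.
apply: lerD.
  by apply: ler_sum => gp f0; rewrite {1}/step f0.
rewrite (eq_bigr _ (fun gp => @potential_step gp t)) sumrB big_split /=.
by rewrite lerBlDr lerD2l; exact: fresh_hit_sum.
Qed.

(** The potential starts at [n] times the harmonic sum. After [n * n + 1] steps no boy is fresh, so
    it has become the number of proposals, which serves as [c]. *)
Lemma girl_cost_sum :
  exists c : rankings n -> nat,
    (forall gp, exists2 mu, stable bp gp mu & girl_cost gp mu <= c gp)%N /\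
    \sum_gp (c gp)%:R <= #|{: rankings n}|%:R * (n%:R * harmonic_sum n).
Proof.
exists (fun gp => #|state gp (n * n).+1|); split=> [gp|].
  apply: stable_of_final; [exact: valid_state | exact: state_final].
have := potential_sum_le (n * n).+1.
rewrite /potential cards0 add0r sumr_const -[X in _ <= X]mulr_natl.
have -> : fresh set0 = setT.
  by apply/setP => b; rewrite !inE; apply/forallP => g; rewrite inE.
rewrite cardsT card_ord; apply: le_trans; apply: ler_sum => gp _.
by rewrite state_final // cards0 /harmonic_sum big_ord0 mulr0 addr0.
Qed.

End Potential.

End DeferredAcceptance.

(** * Uniform rankings with the first [h] places fixed *)

Section FixedHead.

Variables (n : nat) (r0 : {perm 'I_n}) (h : nat).
Implicit Types (r : {perm 'I_n}) (b c p q : 'I_n) (U : {set 'I_n}).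

Definition fixed_head : {set {perm 'I_n}} :=
  [set r : {perm 'I_n} | [forall b, (r0 b < h) ==> (r b == r0 b)]].

Lemma fixed_headP r :
  reflect (forall b, r0 b < h -> r b = r0 b) (r \in fixed_head).
Proof.
rewrite inE; apply: (iffP forallP) => hr b; last by apply/implyP => /hr ->.
by move=> lt; apply/eqP; have := hr b; rewrite lt.
Qed.

Lemma fixed_head_id : r0 \in fixed_head.
Proof. exact/fixed_headP. Qed.

Lemma fixed_head_lt r b : r \in fixed_head -> (r b < h) = (r0 b < h).
Proof.
move=> /fixed_headP hr; apply/idP/idP => [lt|lt]; last by rewrite hr.
have lt0 : r0 ((r0^-1)%g (r b)) < h by rewrite permKV.
by have := hr _ lt0; rewrite permKV => /perm_inj e; rewrite -e.
Qed.

Lemma fixed_head_tperm r p q : h <= p -> h <= q -> r \in fixed_head ->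
  (r * tperm p q)%g \in fixed_head.
Proof.
move=> hp hq /fixed_headP hr; apply/fixed_headP => b lt.
by rewrite permM hr // tpermD //; apply/eqP => e; move: lt; rewrite -e ltnNge ?hp ?hq.
Qed.

Let at1 b p := [set r in fixed_head | r b == p].
Let at2 b p c q := [set r in fixed_head | (r b == p) && (r c == q)].

(** Composing with the transposition of two tail positions maps one set injectively into the other;
    used in both directions, this makes all tail positions equally likely for [b]. *)
Let at1_le b p q : h <= p -> h <= q -> #|at1 b p| <= #|at1 b q|.
Proof.
move=> hp hq; rewrite -(card_imset _ (mulIg (tperm p q))).
apply: subset_leq_card; apply/subsetP => s /imsetP[r]; rewrite inE => /andP[hr /eqP e] ->.
by rewrite inE fixed_head_tperm //= permM e tpermL.
Qed.

Let at2_le b p c q q' : h <= q -> h <= q' -> p != q -> p != q' ->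
  #|at2 b p c q| <= #|at2 b p c q'|.
Proof.
move=> hq hq' nq nq'; rewrite -(card_imset _ (mulIg (tperm q q'))).
apply: subset_leq_card; apply/subsetP => s /imsetP[r].
rewrite inE => /and3P[hr /eqP eb /eqP ec] ->.
rewrite inE fixed_head_tperm //= !permM ec tpermL eqxx andbT eb tpermD //.
  by rewrite eq_sym.
by rewrite eq_sym.
Qed.

Lemma card_tail : h <= n -> #|[set p : 'I_n | h <= p]| = n - h.
Proof.
move=> hn; have ch : #|[set p : 'I_n | p < h]| = h.
  rewrite -sum1dep_card -(big_ord_widen_cond _ xpredT (fun=> 1)) //.
  by rewrite sum1_card card_ord.
have -> : [set p : 'I_n | h <= p] = ~: [set p : 'I_n | p < h].
  by apply/setP => p; rewrite !inE -leqNgt.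
by have := cardsC [set p : 'I_n | p < h]; rewrite card_ord ch; lia.
Qed.

Let sum_at1 b (E : pred {perm 'I_n}) U :
  (forall r, r \in fixed_head -> E r -> r b \in U) ->
  #|[set r in fixed_head | E r]| = \sum_(p in U) #|[set r in at1 b p | E r]|.
Proof.
move=> hE; rewrite -sum1dep_card (partition_big (fun r => r b) (mem U)) /=.
  apply: eq_bigr => p _; rewrite -sum1dep_card; apply: eq_bigl => r.
  by rewrite [in RHS]in_set andbAC.
by move=> r /andP[hr Er]; exact: hE.
Qed.

Lemma card_fixed_head1 b U : h <= n -> h <= r0 b ->
    (forall p, p \in U -> h <= p) ->
  #|[set r in fixed_head | r b \in U]| * (n - h) = #|U| * #|fixed_head|.
Proof.
move=> hn hb hU.
have cst p : h <= p -> #|at1 b p| = #|at1 b (r0 b)|.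
  by move=> hp; apply/eqP; rewrite eqn_leq !at1_le.
have sumU (V : {set 'I_n}) : (forall p, p \in V -> h <= p) ->
    #|[set r in fixed_head | r b \in V]| = #|V| * #|at1 b (r0 b)|.
  move=> hV; rewrite (@sum_at1 b _ V) // -sum_nat_const.
  apply: eq_bigr => p pV; rewrite -(cst p (hV p pV)); congr #|pred_of_set _|.
  by apply/setP => r; rewrite !inE; case: eqP => [->|]; rewrite ?pV ?andbT ?andbF.
rewrite sumU // -card_tail //.
have -> : #|fixed_head| = #|[set r in fixed_head | r b \in [set p : 'I_n | h <= p]]|.
  apply: eq_card => r; rewrite [in RHS]inE; case: (boolP (r \in _)) => //= hr.
  by rewrite inE leqNgt fixed_head_lt // -leqNgt hb.
by rewrite sumU => [|p]; [rewrite mulnA mulnAC | rewrite inE].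
Qed.

(** Once [b] sits at a position of [U], the place of [c] is uniform over the other [n - h - 1] tail
    positions, of which [#|U| - 1] lie in [U]. *)
Lemma card_fixed_head2 b c U : h <= n -> h <= r0 c -> b != c ->
    (forall p, p \in U -> h <= p) ->
  #|[set r in fixed_head | (r b \in U) && (r c \in U)]| * (n - h).-1
    = #|U|.-1 * #|[set r in fixed_head | r b \in U]|.
Proof.
move=> hn hc nbc hU.
have nr r : r b != r c by rewrite inj_eq //; exact: perm_inj.
rewrite (@sum_at1 b _ U); last by move=> r _ /andP[].
rewrite (@sum_at1 b (fun r => r b \in U) U) // big_distrl big_distrr /=.
apply: eq_bigr => p pU.
have hp := hU p pU.
have sumV (V : {set 'I_n}) q0 : (forall q, q \in V -> h <= q) -> h <= q0 -> p != q0 ->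
    #|[set r in at1 b p | r c \in V]| = #|V :\ p| * #|at2 b p c q0|.
  move=> hV hq0 nq0; rewrite -sum_nat_const -sum1dep_card.
  rewrite (partition_big (fun r => r c) (mem (V :\ p))) /=; last first.
    by move=> r; rewrite !inE => /andP[/andP[_ /eqP <-] ->]; rewrite andbT eq_sym.
  apply: eq_bigr => q; rewrite in_setD1 => /andP[nq qV].
  transitivity #|at2 b p c q|.
    rewrite sum1dep_card; apply: eq_card => r; rewrite !inE.
    by case: (r c =P q) => [->|]; rewrite ?andbF ?qV ?andbT.
  have hq := hV q qV; rewrite eq_sym in nq.
  by apply/eqP; rewrite eqn_leq !at2_le.
case: (boolP [exists q0 : 'I_n, (h <= q0) && (p != q0)]) => [|no].
  case/existsP=> q0 /andP[hq0 nq0].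
  have -> : #|[set r in at1 b p | r b \in U]|
      = #|[set r in at1 b p | r c \in [set q : 'I_n | h <= q]]|.
    apply: eq_card => r; rewrite [in LHS]inE [in RHS]inE.
    case: (boolP (r \in _)) => //=; rewrite inE => /andP[hr /eqP ->].
    by rewrite pU inE leqNgt fixed_head_lt // -leqNgt hc.
  rewrite (sumV _ q0) => [|q|//|//]; last by rewrite inE.
  have -> : #|[set r in at1 b p | (r b \in U) && (r c \in U)]|
      = #|[set r in at1 b p | r c \in U]|.
    apply: eq_card => r; rewrite [in LHS]inE [in RHS]inE.
    by case: (boolP (r \in _)) => //=; rewrite inE => /andP[_ /eqP ->]; rewrite pU.
  rewrite (sumV _ q0) //.
  have := cardsD1 p U; rewrite pU /= => ->.
  have := cardsD1 p [set q : 'I_n | h <= q]; rewrite inE hp card_tail // => ->.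
  by rewrite !add1n /= mulnAC mulnA.
(* If [p] is the only tail position, [b] and [c] cannot both be in the tail, and both sides
   vanish. *)
have at1_0 : [set r in at1 b p | r b \in U] = set0.
  apply/setP => r; rewrite !inE; apply/negP => /andP[/andP[hr /eqP e] _].
  move/existsPn: no => /(_ (r c)); rewrite -e nr andbT.
  have hr' : r \in fixed_head by rewrite inE.
  by rewrite leqNgt (fixed_head_lt c hr') -leqNgt hc.
rewrite at1_0 cards0 muln0 (_ : [set r in at1 b p | _] = set0) ?cards0 //.
apply/setP => r; rewrite [in RHS]inE; apply/negP; rewrite inE => /andP[hr /andP[h1 _]].
by have := in_set0 r; rewrite -at1_0 inE hr h1.
Qed.

End FixedHead.

(** * Uniform rankings with the relative order on a set fixed *)

Section KeptOrder.

Variables (n : nat) (r0 : {perm 'I_n}) (P : {set 'I_n}).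
Implicit Types (r : {perm 'I_n}) (x y g : 'I_n).

Definition kept_order : {set {perm 'I_n}} :=
  [set r : {perm 'I_n} | [forall x in P, forall y in P, (r x < r y) == (r0 x < r0 y)]].

Lemma kept_orderP r :
  reflect {in P &, forall x y, (r x < r y) = (r0 x < r0 y)} (r \in kept_order).
Proof.
rewrite inE; apply: (iffP forall_inP) => [hr x y xP yP|hr x xP].
  by move/forall_inP: (hr x xP) => /(_ y yP)/eqP.
by apply/forall_inP => y yP; apply/eqP/hr.
Qed.

Lemma kept_order_id : r0 \in kept_order.
Proof. exact/kept_orderP. Qed.

(* The number of elements of P before g ranges over 0 .. #|P|, and swapping g
   with the i-th element of P exchanges the values i and i + 1. *)
Let slot g r := #|[set x in P | r x < r g]|.

Let slot_class g i := [set r in kept_order | slot g r == i].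

Let nth_before y i := (y \in P) && (#|[set x in P | r0 x < r0 y]| == i).

(** Counting predecessors maps [P] injectively into [0 .. #|P| - 1], hence onto. *)
Let nth_before_exists i : i < #|P| -> exists y, nth_before y i.
Proof.
move=> lt; pose f x := #|[set z in P | r0 z < r0 x]|.
have f_lt x : x \in P -> f x < #|P|.
  move=> xP; apply: proper_card; apply/properP; split.
    by apply/subsetP => z; rewrite inE => /andP[].
  by exists x => //; rewrite inE ltnn andbF.
have f_mono x y : x \in P -> r0 x < r0 y -> f x < f y.
  move=> xP lxy; apply: proper_card; apply/properP; split.
    by apply/subsetP => z; rewrite !inE => /andP[-> /ltn_trans]; exact.
  by exists x; rewrite !inE xP ?lxy ?ltnn.
have f_inj : {in P &, injective f}.
  move=> x y xP yP e.
  case: (ltngtP (r0 x) (r0 y)) => [l|l|/rank_inj //].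
    by have := f_mono _ _ xP l; rewrite e ltnn.
  by have := f_mono _ _ yP l; rewrite e ltnn.
pose F x : 'I_#|P|.+1 := inord (f x).
have FE x : x \in P -> F x = f x :> nat by move=> /f_lt xP; rewrite inordK // ltnW.
have FP : F @: P = [set j : 'I_#|P|.+1 | j < #|P|].
  apply/eqP; rewrite eqEcard; apply/andP; split.
    by apply/subsetP => _ /imsetP[x xP ->]; rewrite inE FE ?f_lt.
  rewrite card_in_imset => [|x y xP yP /(congr1 val)]; last first.
    by rewrite /= !FE //; exact: f_inj.
  rewrite -sum1dep_card -(big_ord_widen_cond _ xpredT (fun=> 1)) //.
  by rewrite sum1_card card_ord.
have : (inord i : 'I_#|P|.+1) \in F @: P by rewrite FP inE inordK // ltnW.
case/imsetP=> y yP /(congr1 val) /=; rewrite inordK ?FE // => [e|]; last exact: ltnW.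
by exists y; rewrite /nth_before yP /= -/(f y) -e.
Qed.

(** With slot [i] or [i + 1], no element of [P] lies strictly between [g] and [y], so exchanging
    these two preserves the order on [P]. *)
Let slot_swap g y i r : g \notin P -> nth_before y i -> r \in kept_order ->
    (slot g r == i) || (slot g r == i.+1) ->
  let r' := (tperm g y * r)%g in
  [/\ r' \in kept_order, slot g r = i -> slot g r' = i.+1
     & slot g r = i.+1 -> slot g r' = i].
Proof.
move=> gP /andP[yP /eqP cy] rK sl r'; have /kept_orderP hr := rK.
have ngP x : x \in P -> g != x by apply: contraTneq => <-.
pose L := [set x in P | r x < r y].
have cL : #|L| = i.
  by rewrite -cy; apply: eq_card => x; rewrite !inE; case: (boolP (x \in P)) => //= xP; rewrite hr.
pose S := [set x in P | r x < r g].
have SE : S = (if r g < r y then L else y |: L).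
  apply/eqP; case: ltnP => lt; [rewrite eqEcard | rewrite eq_sym eqEcard].
    have sub : S \subset L.
      by apply/subsetP => x; rewrite !inE => /andP[-> /ltn_trans]; exact.
    rewrite sub cL /=; move: sl; rewrite /slot -/S => /orP[|] /eqP ->; lia.
  have lt' : r y < r g by rewrite rank_lt // eq_sym ngP.
  have sub : y |: L \subset S.
    apply/subsetP => x; rewrite !inE => /orP[/eqP ->|/andP[-> /ltn_trans]]; last exact.
    by rewrite yP.
  rewrite sub cardsU1 cL inE ltnn andbF add1n /=.
  by move: sl; rewrite /slot -/S => /orP[|] /eqP ->; lia.
have slE : slot g r = (if r g < r y then i else i.+1).
  rewrite /slot -/S SE; case: ifP => _ //.
  by rewrite cardsU1 inE ltnn andbF cL.
have SEx x : x \in P -> x != y -> (r x < r g) = (r x < r y).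
  move=> xP nxy; have: (x \in S) = (x \in L).
    by rewrite SE; case: ifP => // _; rewrite in_setU1 (negbTE nxy).
  by rewrite !inE xP.
have r'x x : x \in P -> x != y -> r' x = r x.
  by move=> xP nxy; rewrite permM tpermD ?ngP // eq_sym.
have r'y : r' y = r g by rewrite permM tpermR.
have r'g : r' g = r y by rewrite permM tpermL.
have gt x : x \in P -> x != y -> (r g < r x) = (r y < r x).
  move=> xP nxy; rewrite !rank_lt ?ngP // 1?eq_sym //.
  by rewrite leqNgt SEx // -leqNgt.
have r'K : r' \in kept_order.
  apply/kept_orderP => x z xP zP; rewrite -hr //.
  case: (x =P y) => [->|/eqP nx]; case: (z =P y) => [->|/eqP nz].
  - by rewrite !ltnn.
  - by rewrite r'y r'x // gt.
  - by rewrite r'y r'x // SEx.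
  - by rewrite !r'x.
have sl' : slot g r' = (if r g < r y then i.+1 else i).
  transitivity #|(if r g < r y then y |: L else L)|; last first.
    by case: ifP => _; rewrite ?cardsU1 ?cL // inE ltnn andbF.
  apply: eq_card => x; rewrite inE r'g.
  case: (x =P y) => [->|/eqP nx].
    rewrite yP r'y /=; case: ifP => lt; first by rewrite in_setU1 eqxx.
    by rewrite inE ltnn andbF.
  case: (boolP (x \in P)) => xP /=.
    by rewrite r'x //; case: ifP => _; rewrite ?in_setU1 ?(negbTE nx) inE xP.
  by case: ifP => _; rewrite ?in_setU1 ?(negbTE nx) inE (negbTE xP).
split=> //; rewrite slE sl'; case: ifP => //; lia.
Qed.

Let card_slot g i : g \notin P -> i < #|P| ->
  #|slot_class g i| = #|slot_class g i.+1|.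
Proof.
move=> gP /nth_before_exists[y yi].
have inj (D : {set {perm 'I_n}}) : {in D &, injective (mulg (tperm g y))}.
  by move=> r r' _ _; exact: mulgI.
apply/eqP; rewrite eqn_leq; apply/andP; split.
  rewrite -(card_in_imset (inj (slot_class g i))); apply: subset_leq_card.
  apply/subsetP => s /imsetP[r]; rewrite inE => /andP[rK /eqP e] ->.
  have [] := slot_swap gP yi rK; first by rewrite e eqxx.
  by move=> r'K /(_ e) sl' _; rewrite inE r'K sl' /=.
rewrite -(card_in_imset (inj (slot_class g i.+1))); apply: subset_leq_card.
apply/subsetP => s /imsetP[r]; rewrite inE => /andP[rK /eqP e] ->.
have [] := slot_swap gP yi rK; first by rewrite e eqxx orbT.
by move=> r'K _ /(_ e) sl'; rewrite inE r'K sl' /=.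
Qed.

(** The [#|P| + 1] slots of [g] are equally likely, and [g] precedes the first element [m] exactly
    in slot 0. *)
Lemma card_kept_order_first m g : m \in P -> g \notin P ->
    (forall x, x \in P -> r0 m <= r0 x) ->
  #|[set r in kept_order | r g < r m]| * #|P|.+1 = #|kept_order|.
Proof.
move=> mP gP m_min.
have cst i : i <= #|P| -> #|slot_class g i| = #|slot_class g 0|.
  by elim: i => // i IH lt; rewrite -card_slot // IH // ltnW.
have -> : [set r in kept_order | r g < r m] = slot_class g 0.
  apply/setP => r; rewrite [in LHS]in_set [in RHS]in_set.
  case: (boolP (r \in kept_order)) => //= rK; have /kept_orderP hr := rK.
  rewrite cards_eq0; apply/idP/eqP => [lt|e].
    apply/setP => x; rewrite !inE; apply/negP => /andP[xP lx].
    have := ltn_trans lx lt; rewrite hr // => h.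
    by have := m_min x xP; rewrite leqNgt h.
  have : m \notin [set x in P | r x < r g] by rewrite e inE.
  rewrite inE mP /= -leqNgt => le; rewrite rank_lt //.
  by apply: contraNneq gP => ->.
rewrite mulnC -[in RHS]sum1_card.
rewrite [RHS](partition_big (fun r => inord (slot g r) : 'I_#|P|.+1) xpredT) //=.
rewrite -{1}(card_ord #|P|.+1) -sum_nat_const; apply: eq_bigr => i _.
have le_i : i <= #|P| by rewrite -ltnS.
rewrite -(cst i le_i) /slot_class -sum1dep_card; apply: eq_bigl => r.
congr (_ && _); rewrite -val_eqE /= inordK // ltnS.
by apply: subset_leq_card; apply/subsetP => x; rewrite inE => /andP[].
Qed.

End KeptOrder.

(** * Product events under the uniform law on a product of finite sets *)

Section Box.

Local Open Scope ring_scope.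

Variables (R : realFieldType) (T V : finType) (A : T -> {set V}).
Implicit Types (ev : T -> pred V) (E : pred V) (x : T).

Definition box : {set {ffun T -> V}} := [set f : {ffun T -> V} | [forall x, f x \in A x]].

Lemma card_box : #|box| = (\prod_x #|A x|)%N.
Proof.
have -> : #|box| = #|(family (fun x => mem (A x)) : {pred {ffun T -> V}})|.
  by apply: eq_card => f; rewrite inE.
by rewrite card_family foldrE big_map big_enum.
Qed.

Definition frac x E : R := #|[set v in A x | E v]|%:R / #|A x|%:R.

Definition prob ev : R := \prod_x frac x (ev x).

Hypothesis A_neq0 : forall x, A x != set0.

Lemma frac_eq x E (k m : nat) : (0 < m)%N ->
  (#|[set v in A x | E v]| * m = k * #|A x|)%N -> frac x E = k%:R / m%:R.
Proof.
move=> m0 e; apply/eqP; rewrite eqr_div ?pnatr_eq0 ?cards_eq0 ?A_neq0 -?lt0n //.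
by rewrite -!natrM e.
Qed.

Lemma frac1 x E : (forall v, E v) -> frac x E = 1.
Proof.
move=> hE; rewrite /frac (_ : [set v in A x | E v] = A x).
  by rewrite divff // pnatr_eq0 cards_eq0.
by apply/setP => v; rewrite inE hE andbT.
Qed.

Lemma eq_frac x E E' : E =1 E' -> frac x E = frac x E'.
Proof.
move=> eE; rewrite /frac; congr (_%:R / _).
by apply: eq_card => v; rewrite !inE eE.
Qed.

Lemma card_box_event ev :
  #|[set f in box | [forall x, ev x (f x)]]|%:R = prob ev * #|box|%:R.
Proof.
have -> : #|[set f in box | [forall x, ev x (f x)]]|
    = (\prod_x #|[set v in A x | ev x v]|)%N.
  have -> : #|[set f in box | [forall x, ev x (f x)]]| =
      #|(family (fun x => mem [set v in A x | ev x v]) : {pred {ffun T -> V}})|.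
    apply: eq_card => f; rewrite !inE; apply/andP/forallP => [[/forallP a /forallP b] x|h].
      by rewrite /= inE a b.
    by split; apply/forallP => x; have := h x; rewrite /= inE => /andP[].
  by rewrite card_family foldrE big_map big_enum.
rewrite card_box !natr_prod -big_split /=; apply: eq_bigr => x _.
by rewrite divfK // pnatr_eq0 cards_eq0.
Qed.

Lemma prob_indep ev1 ev2 :
  (forall x, (forall v, ev1 x v) \/ (forall v, ev2 x v)) ->
  prob (fun x v => ev1 x v && ev2 x v) = prob ev1 * prob ev2.
Proof.
move=> sup; rewrite /prob -big_split; apply: eq_bigr => x _ /=.
case: (sup x) => h; [rewrite (@frac1 x (ev1 x)) // mul1r | rewrite (@frac1 x (ev2 x)) // mulr1].
  by apply: eq_frac => v; rewrite h.
by apply: eq_frac => v; rewrite h andbT.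
Qed.

Lemma prob1 ev x : (forall y v, y != x -> ev y v) -> prob ev = frac x (ev x).
Proof.
move=> hev; rewrite /prob (bigD1 x) //= big1 ?mulr1 // => y nyx.
by apply: frac1 => v; exact: hev.
Qed.

Lemma prob2 ev x x' : x != x' -> (forall y v, y != x -> y != x' -> ev y v) ->
  prob ev = frac x (ev x) * frac x' (ev x').
Proof.
move=> nxx hev; rewrite /prob (bigD1 x) //= (bigD1 x') 1?eq_sym //=.
rewrite big1 ?mulr1 // => y /andP[nyx nyx'].
by apply: frac1 => v; exact: hev.
Qed.

End Box.

(** * The law given the proposals, and the second moment method for clear pairs *)

Section InstanceClass.

Local Open Scope ring_scope.

Variables (R : realFieldType) (n : nat) (bp0 gp0 : rankings n) (mu : {perm 'I_n}).
Implicit Types (g c x : 'I_n) (b y : 'I_n) (e f : 'I_n * 'I_n).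
Implicit Types (I : rankings n * rankings n).

Definition partner g := (mu^-1)%g g.
(** For a girl-optimal [mu] the head of [g] consists of the boys to whom she proposes, her partner
    being the last. *)
Definition head_size g := (gp0 g (partner g)).+1.
Definition in_head g b := (gp0 g b < head_size g)%N.
Definition suitors b := [set g | in_head g b].

Definition girl_class g := fixed_head (gp0 g) (head_size g).
Definition boy_class b := kept_order (bp0 b) (suitors b).

(** Conditioning on the revealed part of the preferences means passing to the uniform law on this
    class; being a product, it keeps all lists independent. *)
Definition inst_class : {set rankings n * rankings n} :=
  [set I | (I.1 \in box boy_class) && (I.2 \in box girl_class)].

(** A consequence of the stability of [mu]: each boy is matched to his favourite suitor. *)
Hypothesis mu_best : forall g b, in_head g b -> (bp0 b (mu b) <= bp0 b g)%N.

Let girl_class_neq0 g : girl_class g != set0.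
Proof. by apply/set0Pn; exists (gp0 g); exact: fixed_head_id. Qed.

Let boy_class_neq0 b : boy_class b != set0.
Proof. by apply/set0Pn; exists (bp0 b); exact: kept_order_id. Qed.

Lemma head_size_le g : (head_size g <= n)%N.
Proof. exact: ltn_ord. Qed.

Lemma in_head_partner g : in_head g (partner g).
Proof. exact: leqnn. Qed.

Lemma partner_inj : injective partner.
Proof. exact: perm_inj. Qed.

Lemma mu_partner g : mu (partner g) = g.
Proof. exact: permKV. Qed.

(* Boys are indexed by their partners in mu. *)
Definition weight g : R := (#|suitors (partner g)|.+1%:R)^-1.

Lemma weight_gt0 g : 0 < weight g.
Proof. by rewrite invr_gt0 ltr0n. Qed.

Lemma weight_ge0 g : 0 <= weight g.
Proof. exact/ltW/weight_gt0. Qed.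

(** The boy's partner [c] is the first of his suitors, so [g], who is not one of them, must fall
    into the first of the slots that they delimit. *)
Lemma frac_boy g c : ~~ in_head g (partner c) ->
  frac R boy_class (partner c) (fun r => r g < r c)%N = weight c.
Proof.
move=> ng; rewrite (@frac_eq _ _ _ _ boy_class_neq0 _ _ 1%N #|suitors (partner c)|.+1) //.
  by rewrite mul1r.
rewrite mul1n -(@card_kept_order_first _ _ _ c g) ?inE //; first exact: in_head_partner.
by move=> x; rewrite inE => /mu_best; rewrite mu_partner.
Qed.

Definition event := 'I_n -> pred {perm 'I_n}.

Definition occurs (evB evG : event) I :=
  [forall y, evB y (I.1 y)] && [forall x, evG x (I.2 x)].

Definition class_prob (E : pred (rankings n * rankings n)) : R :=
  #|[set I in inst_class | E I]|%:R / #|inst_class|%:R.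

Lemma inst_class_gt0 : 0 < #|inst_class|%:R :> R.
Proof.
rewrite ltr0n; apply/card_gt0P; exists (bp0, gp0); rewrite inE /= !inE.
by apply/andP; split; apply/forallP => x; [exact: kept_order_id | exact: fixed_head_id].
Qed.

Lemma class_prob_occurs evB evG :
  class_prob (occurs evB evG) = prob R boy_class evB * prob R girl_class evG.
Proof.
have card2 (E1 E2 : pred (rankings n)) :
    #|[set I in inst_class | E1 I.1 && E2 I.2]| =
    (#|[set f in box boy_class | E1 f]| * #|[set f in box girl_class | E2 f]|)%N.
  rewrite -cardsX; apply: eq_card => I; rewrite !in_set.
  by rewrite [RHS]andbACA.
rewrite /class_prob.
have cC : #|inst_class| = (#|box boy_class| * #|box girl_class|)%N.
  by rewrite -cardsX; apply: eq_card => I; rewrite !in_set.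
have -> : #|[set I in inst_class | occurs evB evG I]| =
    (#|[set f in box boy_class | [forall y, evB y (f y)]]| *
     #|[set f in box girl_class | [forall y, evG y (f y)]]|)%N.
  exact: (card2 (fun f : rankings n => [forall y, evB y (f y)]) (fun f : rankings n => [forall y, evG y (f y)])).
have := inst_class_gt0; rewrite cC !natrM => /lt0r_neq0.
rewrite mulf_eq0 negb_or => /andP[nB nG].
rewrite !(card_box_event R) //.
by rewrite invfM mulrACA mulrA -mulrA; field; rewrite nB nG.
Qed.

Lemma class_prob_le (E E' : pred (rankings n * rankings n)) :
  (forall I, I \in inst_class -> E I -> E' I) -> class_prob E <= class_prob E'.
Proof.
move=> sub; rewrite /class_prob ler_pM2r ?invr_gt0 ?inst_class_gt0 // ler_nat.
apply: subset_leq_card; apply/subsetP => I; rewrite [in X in X -> _]in_set [in X in _ -> X]in_set.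
by case/andP=> IC /(sub I IC) ->; rewrite IC.
Qed.

Lemma eq_class_prob (E E' : pred (rankings n * rankings n)) :
  E =1 E' -> class_prob E = class_prob E'.
Proof. by move=> e; apply/le_anti/andP; split; apply: class_prob_le => I _; rewrite e. Qed.

Variable L : nat.

Definition window g := [set p : 'I_n | (head_size g <= p < head_size g + L)%N].

(** The window fits into the list, the denominator of [beta] is positive, and at least half of the
    list lies below the head. *)
Definition good g :=
  [&& (head_size g + L <= n)%N, (head_size g + 2 <= n)%N & (head_size g).*2 <= n]%N.

(** [alpha] is the probability that a given boy below the head falls into the window, [beta] the
    conditional probability that a second one does too. *)
Definition alpha g : R := L%:R / (n - head_size g)%:R.
Definition beta g : R := L.-1%:R / (n - head_size g).-1%:R.

Lemma alpha_ge0 g : 0 <= alpha g.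
Proof. by rewrite divr_ge0 ?ler0n. Qed.

Lemma beta_ge0 g : 0 <= beta g.
Proof. by rewrite divr_ge0 ?ler0n. Qed.

Lemma card_window g : good g -> #|window g| = L.
Proof.
case/and3P=> gg _ _; rewrite -sum1dep_card.
rewrite -(big_ord_widen_cond _ (fun p => head_size g <= p)%N (fun=> 1%N)) //.
rewrite big_split_ord /= big_pred0 => [|i]; last by rewrite leqNgt ltn_ord.
rewrite add0n (eq_bigl xpredT) => [|i]; last by rewrite leq_addr.
by rewrite sum1_card card_ord.
Qed.

Lemma window_ge g p : p \in window g -> (head_size g <= p)%N.
Proof. by rewrite inE => /andP[]. Qed.

Lemma frac_girl1 g b : good g -> ~~ in_head g b ->
  frac R girl_class g (fun r => r b \in window g) = alpha g.
Proof.
move=> gg hb; apply: frac_eq => //; first by case/and3P: gg; lia.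
rewrite card_fixed_head1 ?head_size_le ?card_window //; first by rewrite leqNgt.
exact: window_ge.
Qed.

Lemma frac_girl2 g b c : good g -> ~~ in_head g b -> ~~ in_head g c -> b != c ->
  frac R girl_class g (fun r => (r b \in window g) && (r c \in window g))
    = alpha g * beta g.
Proof.
move=> gg hb hc nbc; rewrite -(frac_girl1 gg hb) /frac /beta.
have := @card_fixed_head2 n (gp0 g) (head_size g) b c (window g) (head_size_le g).
rewrite leqNgt hc => /(_ isT nbc (@window_ge g)); rewrite card_window // => e.
have m0 : (n - head_size g).-1%:R != 0 :> R.
  by rewrite pnatr_eq0; case/and3P: gg; lia.
have a0 : #|girl_class g|%:R != 0 :> R by rewrite pnatr_eq0 cards_eq0.
have := congr1 (fun k => k%:R : R) e; rewrite !natrM => eR.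
apply: (mulIf m0); apply: (mulIf a0).
rewrite -[LHS]mulrA [_%:R * #|_|%:R]mulrC -[LHS]mulrA mulKf ?divfK //.
rewrite /girl_class eR; field; rewrite m0 -?/(girl_class g) ?a0 //.
Qed.

(** Written list by list, with trivial conditions on all lists but two, so that [mutual] is a
    product event. *)
Definition evG e : event := fun x r =>
  ((x == e.1) ==> (r (partner e.2) \in window e.1)) &&
  ((x == e.2) ==> (r (partner e.1) \in window e.2)).

Definition evB e : event := fun y r =>
  ((y == partner e.1) ==> (r e.2 < r e.1)%N) &&
  ((y == partner e.2) ==> (r e.1 < r e.2)%N).

Definition mutual e := occurs (evB e) (evG e).

(** Neither girl has proposed to the other's partner, so the revealed proposals leave [mutual e]
    undecided. *)
Definition cand e := [&& good e.1, good e.2,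
  ~~ in_head e.1 (partner e.2) & ~~ in_head e.2 (partner e.1)].

Definition pair_prob e : R :=
  alpha e.1 * alpha e.2 * (weight e.1 * weight e.2).

Lemma pair_prob_ge0 e : 0 <= pair_prob e.
Proof.
have a0 := mulr_ge0 (alpha_ge0 e.1) (alpha_ge0 e.2).
exact: mulr_ge0 a0 (mulr_ge0 (weight_ge0 e.1) (weight_ge0 e.2)).
Qed.

Lemma cand_neq e : cand e -> e.1 != e.2.
Proof.
case/and4P=> _ _ + _; apply: contraNneq => ->; exact: in_head_partner.
Qed.

Lemma prob_evB e : cand e -> prob R boy_class (evB e) = weight e.1 * weight e.2.
Proof.
move=> ce; have ne := cand_neq ce; case/and4P: ce => _ _ h1 h2.
have np : partner e.1 != partner e.2 by rewrite (inj_eq partner_inj).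
rewrite (@prob2 _ _ _ _ boy_class_neq0 _ _ _ np) => [|y r n1 n2]; last first.
  by rewrite /evB (negbTE n1) (negbTE n2).
rewrite -(frac_boy h2) -(frac_boy h1); congr (_ * _); apply: eq_frac => r.
  by rewrite /evB eqxx (negbTE np) andbT.
by rewrite /evB eqxx eq_sym (negbTE np).
Qed.

Lemma prob_evG e : cand e -> prob R girl_class (evG e) = alpha e.1 * alpha e.2.
Proof.
move=> ce; have ne := cand_neq ce; case/and4P: ce => g1 g2 h1 h2.
rewrite (@prob2 _ _ _ _ girl_class_neq0 _ _ _ ne) => [|y r n1 n2]; last first.
  by rewrite /evG (negbTE n1) (negbTE n2).
rewrite -(frac_girl1 g1 h1) -(frac_girl1 g2 h2); congr (_ * _); apply: eq_frac => r.
  by rewrite /evG eqxx (negbTE ne) andbT.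
by rewrite /evG eqxx eq_sym (negbTE ne).
Qed.

Lemma prob_mutual e : cand e -> class_prob (mutual e) = pair_prob e.
Proof.
by move=> ce; rewrite class_prob_occurs prob_evB // prob_evG // mulrC.
Qed.

Lemma occurs_and evB1 evG1 evB2 evG2 I :
  occurs evB1 evG1 I && occurs evB2 evG2 I =
  occurs (fun y r => evB1 y r && evB2 y r) (fun x r => evG1 x r && evG2 x r) I.
Proof.
rewrite /occurs andbACA; congr (_ && _);
  by apply/andP/forallP => [[/forallP a /forallP b] z|h];
    [rewrite a b | split; apply/forallP => z; case/andP: (h z)].
Qed.

Definition disjoint_pairs e f :=
  [&& e.1 != f.1, e.1 != f.2, e.2 != f.1 & e.2 != f.2].

Lemma prob_mutual_indep e f : cand e -> cand f -> disjoint_pairs e f ->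
  class_prob (fun I => mutual e I && mutual f I) = pair_prob e * pair_prob f.
Proof.
move=> ce cf /and4P[n11 n12 n21 n22].
have neq : ((f.1 == e.1) = false) * ((f.1 == e.2) = false) *
    (((f.2 == e.1) = false) * ((f.2 == e.2) = false)).
  by rewrite ![f.1 == _]eq_sym ![f.2 == _]eq_sym !(negbTE n11, negbTE n12, negbTE n21, negbTE n22).
rewrite (eq_class_prob (occurs_and _ _ _ _)) class_prob_occurs.
rewrite (@prob_indep _ _ _ _ boy_class_neq0 (evB e) (evB f)).
rewrite (@prob_indep _ _ _ _ girl_class_neq0 (evG e) (evG f)).
- by rewrite !prob_evB // !prob_evG // /pair_prob; ring.
- move=> x; case: (boolP ((x == f.1) || (x == f.2))) => [xf|nf]; [left|right] => r.
    by rewrite /evG; case/orP: xf => /eqP ->; rewrite !neq.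
  by move: nf; rewrite negb_or /evG => /andP[/negbTE -> /negbTE ->].
- move=> x; case: (boolP ((x == partner f.1) || (x == partner f.2))) => [xf|nf]; [left|right] => r.
    by rewrite /evB; case/orP: xf => /eqP ->; rewrite !(inj_eq partner_inj) !neq.
  by move: nf; rewrite negb_or /evB => /andP[/negbTE -> /negbTE ->].
Qed.

(* The boy matched to c would accept g and is in g's window; a pair is clear if
   each of the two girls has the partner of the other one as her only such boy. *)
Definition rival g c I :=
  (I.2 g (partner c) \in window g) && (I.1 (partner c) g < I.1 (partner c) c)%N.

(** The list of [partner c] is independent of [mutual e] and contributes [weight c]. The list of
    [e.1] is shared: a second boy in its window costs the factor [beta e.1]. If [partner c] is in
    the head of [e.1], the event is empty, because the window starts below the head. *)
Lemma prob_rival e c : cand e -> c != e.1 -> c != e.2 ->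
  class_prob (fun I => mutual e I && rival e.1 c I)
    <= pair_prob e * (weight c * beta e.1).
Proof.
move=> ce nc1 nc2; have ne := cand_neq ce; have := ce; case/and4P=> g1 g2 h1 h2.
case: (boolP (in_head e.1 (partner c))) => hc.
  have p0 : 0 <= pair_prob e * (weight c * beta e.1).
    exact: mulr_ge0 (pair_prob_ge0 e) (mulr_ge0 (weight_ge0 c) (beta_ge0 e.1)).
  apply: le_trans p0; rewrite /class_prob (_ : [set I in _ | _] = set0) ?cards0 ?mul0r //.
  apply/setP => I; rewrite [in RHS]in_set; apply/negP; rewrite in_set.
  case/andP; rewrite in_set => /andP[_]; rewrite in_set => /forallP/(_ e.1).
  move=> /(fixed_head_lt (partner c)) eh /andP[_ /andP[/window_ge]].
  by rewrite leqNgt eh -/(in_head _ _) hc.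
pose rB : event := fun y r => (y == partner c) ==> (r e.1 < r c)%N.
pose rG : event := fun x r => (x == e.1) ==> (r (partner c) \in window e.1).
have rivalE I : rival e.1 c I = occurs rB rG I.
  rewrite /rival /occurs andbC; congr (_ && _).
    apply/idP/forallP => [h y|/(_ (partner c))]; last by rewrite /rB eqxx.
    by apply/implyP => /eqP ->.
  apply/idP/forallP => [h y|/(_ e.1)]; last by rewrite /rG eqxx.
  by apply/implyP => /eqP ->.
rewrite (@eq_class_prob _ (fun I => mutual e I && occurs rB rG I)); last by move=> I; rewrite rivalE.
rewrite (eq_class_prob (occurs_and _ _ _ _)) class_prob_occurs.
rewrite (@prob_indep _ _ _ _ boy_class_neq0 (evB e) rB); last first.
  move=> y; case: (eqVneq y (partner c)) => [->|ny]; [left|right] => r.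
    by rewrite /evB !(inj_eq partner_inj) (negbTE nc1) (negbTE nc2).
  by rewrite /rB (negbTE ny).
rewrite prob_evB // (@prob1 _ _ _ _ boy_class_neq0 rB (partner c)); last first.
  by move=> y r ny; rewrite /rB (negbTE ny).
rewrite [frac _ _ _ _](_ : _ = weight c); last first.
  by rewrite -(frac_boy hc); apply: eq_frac => r; rewrite /rB eqxx.
rewrite (@prob2 _ _ _ _ girl_class_neq0 _ _ _ ne); last first.
  by move=> x r n1 n2; rewrite /evG /rG (negbTE n1) (negbTE n2).
have nbc : partner e.2 != partner c by rewrite (inj_eq partner_inj) eq_sym.
rewrite [X in _ * (X * _)](_ : _ = alpha e.1 * beta e.1); last first.
  rewrite -(frac_girl2 g1 h1 hc nbc); apply: eq_frac => r.
  by rewrite /evG /rG eqxx (negbTE ne) andbT.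
rewrite [X in _ * (_ * X)](_ : _ = alpha e.2); last first.
  rewrite -(frac_girl1 g2 h2); apply: eq_frac => r.
  by rewrite /evG /rG eqxx eq_sym (negbTE ne) andbT.
by rewrite /pair_prob le_eqVlt; apply/orP; left; apply/eqP; ring.
Qed.

Definition cexp (X : rankings n * rankings n -> R) : R :=
  (\sum_(I in inst_class) X I) / #|inst_class|%:R.

Lemma cexp_prob (E : pred (rankings n * rankings n)) :
  cexp (fun I => (E I)%:R) = class_prob E.
Proof.
rewrite /cexp /class_prob -sum1dep_card natr_sum; congr (_ / _).
rewrite big_mkcond [RHS]big_mkcond; apply: eq_bigr => I _.
by case: (I \in _) => //=; case: (E I).
Qed.

Lemma cexp_le X Y : (forall I, I \in inst_class -> X I <= Y I) -> cexp X <= cexp Y.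
Proof.
move=> le; rewrite /cexp ler_pM2r ?invr_gt0 ?inst_class_gt0 //.
exact: ler_sum.
Qed.

Lemma cexpD X Y : cexp (fun I => X I + Y I) = cexp X + cexp Y.
Proof. by rewrite /cexp big_split mulrDl. Qed.

Lemma cexpZ a X : cexp (fun I => a * X I) = a * cexp X.
Proof. by rewrite /cexp -mulr_sumr mulrA. Qed.

Lemma cexp_sum (J : finType) (Q : pred J) (X : J -> rankings n * rankings n -> R) :
  cexp (fun I => \sum_(j | Q j) X j I) = \sum_(j | Q j) cexp (X j).
Proof. by rewrite /cexp exchange_big mulr_suml. Qed.

Definition clear e I := mutual e I &&
  [forall c, (c != e.1) && (c != e.2) ==> ~~ rival e.1 c I && ~~ rival e.2 c I].

Let rev e := (e.2, e.1).

Lemma mutualP e I : e.1 != e.2 ->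
  mutual e I = rival e.1 e.2 I && rival e.2 e.1 I.
Proof.
move=> ne; rewrite /mutual /occurs /rival.
have np : partner e.1 != partner e.2 by rewrite (inj_eq partner_inj).
apply/andP/andP => [[/forallP hB /forallP hG]|[/andP[g1 b1] /andP[g2 b2]]].
  have := hB (partner e.1); have := hB (partner e.2); have := hG e.1; have := hG e.2.
  rewrite /evB /evG !eqxx (negbTE ne) (negbTE np) ![e.2 == _]eq_sym (negbTE ne).
  rewrite [partner e.2 == _]eq_sym (negbTE np) /= !andbT.
  by move=> -> -> -> ->.
split; apply/forallP => x; rewrite /evB /evG; apply/andP.
  by split; apply/implyP => /eqP ->.
by split; apply/implyP => /eqP ->.
Qed.

Lemma mutual_rev e I : e.1 != e.2 -> mutual (rev e) I = mutual e I.
Proof. by move=> ne; rewrite !mutualP //= 1?eq_sym // andbC. Qed.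

Lemma clear_rev e I : e.1 != e.2 -> clear (rev e) I = clear e I.
Proof.
move=> ne; rewrite /clear mutual_rev //=; congr (_ && _).
by apply: eq_forallb => c; rewrite [(c != e.2) && _]andbC [~~ rival e.2 _ _ && _]andbC.
Qed.

Lemma cand_rev e : cand (rev e) = cand e.
Proof.
rewrite /cand /=; case: (good e.1); case: (good e.2) => //=.
by rewrite andbC.
Qed.

(** Since [f] is mutual, the boy matched to [f.2] is a rival at [e.1]; clarity of [e] leaves only
    [f.2 = e.2]. *)
Lemma clear_fst e f I : cand e -> cand f -> clear e I -> mutual f I ->
  e.1 = f.1 -> e = f.
Proof.
case: e f => [e1 e2] [f1 f2] ce cf /andP[_ /forallP/(_ f2)] /= no mf e1f1.
move: cf mf no; rewrite -e1f1 => cf mf.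
have nf := cand_neq cf; rewrite mutualP //= in mf; case/andP: mf => -> _ /=.
by rewrite eq_sym nf /=; case: eqP => [->|].
Qed.

(** Reversing [e] or [f] reduces every overlap to a common first girl. As pairs are ordered, the
    reversal of [e] remains possible. *)
Lemma clear_overlap e f I : cand e -> cand f -> clear e I -> clear f I ->
  ~~ disjoint_pairs e f -> f = e \/ f = rev e.
Proof.
move=> ce cf he hf.
have [me mf] : mutual e I /\ mutual f I by case/andP: he => ->; case/andP: hf => ->.
have [ne nf] := (cand_neq ce, cand_neq cf).
have he' : clear (rev e) I by rewrite clear_rev.
have mf' : mutual (rev f) I by rewrite mutual_rev.
have ce' : cand (rev e) by rewrite cand_rev.
have cf' : cand (rev f) by rewrite cand_rev.
rewrite /disjoint_pairs !negb_and !negbK => /or4P[]/eqP h.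
- by left; rewrite (clear_fst ce cf he mf h).
- right; have := clear_fst ce cf' he mf' h; move: h => _ -> .
  by case: (f).
- by right; rewrite -(clear_fst ce' cf he' mf h).
- left; have := clear_fst ce' cf' he' mf' h; case: e f {ce cf he hf me mf ne nf he' mf' ce' cf' h} => ? ? [? ?].
  by case=> -> ->.
Qed.

Definition total_weight : R := \sum_g weight g.

Hypothesis beta_small : forall g, good g -> total_weight * beta g <= 4%:R^-1.

(** Union bound over the rivals: given [mutual e], each of the two girls has at most
    [W * beta <= 1 / 4] further rivals on average, where [W] is the total weight. *)
Lemma prob_clear e : cand e -> pair_prob e / 2%:R <= class_prob (clear e).
Proof.
move=> ce; have ne := cand_neq ce.
pose other c := (c != e.1) && (c != e.2).
have split_le : class_prob (mutual e) <= class_prob (clear e) +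
    \sum_(c | other c) (class_prob (fun I => mutual e I && rival e.1 c I) +
                        class_prob (fun I => mutual e I && rival e.2 c I)).
  rewrite -!cexp_prob; under eq_bigr do rewrite -!cexp_prob -cexpD.
  rewrite -cexp_sum -cexpD; apply: cexp_le => I _.
  have sum0 (Q : pred 'I_n) : 0 <= \sum_(c | Q c)
      ((mutual e I && rival e.1 c I)%:R + (mutual e I && rival e.2 c I)%:R) :> R.
    by apply: sumr_ge0 => c _; rewrite addr_ge0 ?ler0n.
  rewrite /clear; case: (mutual e I) sum0 => [|sum0]; last by rewrite /= addr_ge0.
  rewrite /=; case: forallP => [_ sum0|]; first by rewrite lerDl.
  move=> /forallP; rewrite negb_forall => /existsP[c].
  rewrite negb_imply negb_and !negbK => /andP[oc riv] sum0.
  rewrite add0r (bigD1 c) //= -[1]addr0 lerD //.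
    case: (rival e.1 c I) riv => [_|/= ->].
      by rewrite !addr0 mulr1n lerDl mulrn_wge0.
    by rewrite !addr0 mulr0n add0r.
  by apply: sumr_ge0 => i _; rewrite !addr0 addr_ge0 ?ler0n.
have rival_le : \sum_(c | other c) (class_prob (fun I => mutual e I && rival e.1 c I) +
                        class_prob (fun I => mutual e I && rival e.2 c I))
   <= pair_prob e * (total_weight * beta e.1 + total_weight * beta e.2).
  apply: (@le_trans _ _ (\sum_c (pair_prob e * (weight c * beta e.1) + pair_prob e * (weight c * beta e.2)))).
    rewrite big_mkcond /=; apply: ler_sum => c _.
    case: ifP => [/andP[n1 n2]|_]; last first.
      have term0 g := mulr_ge0 (pair_prob_ge0 e) (mulr_ge0 (weight_ge0 c) (beta_ge0 g)).
      exact: addr_ge0 (term0 _) (term0 _).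
    apply: lerD; first exact: prob_rival.
    have ce' : cand (rev e) by rewrite cand_rev.
    have := @prob_rival (rev e) c ce' n2 n1; rewrite /=.
    rewrite (@eq_class_prob _ (fun I => mutual e I && rival e.2 c I)); last first.
      by move=> I; rewrite mutual_rev.
    by rewrite /pair_prob /= [alpha e.2 * _]mulrC [weight e.2 * weight e.1]mulrC.
  rewrite big_split /= -!mulr_sumr -!mulr_suml -/total_weight.
  by rewrite mulrDr.
have [b1 b2] : total_weight * beta e.1 <= 4%:R^-1 /\ total_weight * beta e.2 <= 4%:R^-1.
  by case/and4P: ce => g1 g2 _ _; split; exact: beta_small.
move: split_le; rewrite prob_mutual // => split_le.
have p0 := pair_prob_ge0 e.
have : pair_prob e * (total_weight * beta e.1 + total_weight * beta e.2) <= pair_prob e / 2%:R.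
  by apply: ler_wpM2l => //; lra.
lra.
Qed.

Definition expected_pairs : R := \sum_(e | cand e) pair_prob e.

(* Second moment method, through 1[X > 0] >= 2 a X - a^2 X^2 for the number X
   of clear pairs and a = 1 / (2 (1 + S)) with S = expected_pairs. *)
Lemma prob_some_clear :
  expected_pairs / (4%:R * (1 + expected_pairs)) <=
  class_prob (fun I => [exists e, cand e && clear e I]).
Proof.
set S := expected_pairs.
have S0 : 0 <= S by apply: sumr_ge0 => e _; exact: pair_prob_ge0.
pose X I : R := \sum_(e | cand e) (clear e I)%:R.
pose Y I : R := \sum_(e | cand e) \sum_(f | cand f && disjoint_pairs e f)
   (mutual e I && mutual f I)%:R.
have EX : S / 2%:R <= cexp X.
  rewrite cexp_sum /S mulr_suml; apply: ler_sum => e ce.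
  by rewrite cexp_prob; exact: prob_clear.
have EY : cexp Y <= S * S.
  rewrite cexp_sum {1}/S /expected_pairs mulr_suml; apply: ler_sum => e ce.
  rewrite cexp_sum mulr_sumr.
  rewrite [leRHS](bigID (disjoint_pairs e)) /= -[leLHS]addr0 lerD //; last first.
    by apply: sumr_ge0 => f _; rewrite mulr_ge0 ?pair_prob_ge0.
  apply: ler_sum => f /andP[cf dj]; rewrite cexp_prob prob_mutual_indep //.
(* In the square, a clear pair overlaps at most two clear pairs, itself and its reversal; the
   disjoint pairs are bounded by [Y]. *)
have XX I : X I * X I <= 2%:R * X I + Y I.
  rewrite {1}/X mulr_suml [2%:R * _]mulr_sumr -big_split /=; apply: ler_sum => e ce.
  rewrite /X (bigID (disjoint_pairs e)) /= mulrDr addrC; apply: lerD; last first.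
    rewrite mulrC; case: (boolP (clear e I)) => he; last by rewrite mulr0n !mulr0.
    have -> : true%:R = 1 :> R by [].
    rewrite !mulr1.
    apply: (@le_trans _ _ (\sum_(f in [:: e; rev e]) 1)).
      rewrite big_mkcond [leRHS]big_mkcond /=; apply: ler_sum => f _.
      case: ifP => [/andP[cf ndj]|_]; last by case: ifP.
      case: (boolP (clear f I)) => hf; last by case: ifP.
      by case: (clear_overlap ce cf he hf ndj) => ->; rewrite !inE eqxx ?orbT.
    rewrite sumr_const ler_nat; exact: card_size.
  rewrite mulr_sumr; apply: ler_sum => f _.
  rewrite -natrM mulnb ler_nat /clear.
  by case: (mutual e I); case: (mutual f I); case: [forall c, _]; case: [forall c, _].
pose a : R := (2%:R * (1 + S))^-1.
have S1 : 0 < 1 + S by lra.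
have a0 : 0 < a by rewrite invr_gt0; lra.
have aE : a * (1 + S) = 2%:R^-1 by rewrite /a; field; lra.
rewrite -cexp_prob.
(* Inserting the bound on [X * X] into [2 a X - a ^ 2 X ^ 2] gives this integrand; by [EX] and [EY]
   its mean is at least [a S (1 - a (1 + S)) = a S / 2]. *)
apply: (@le_trans _ _ (cexp (fun I => (2%:R * a - 2%:R * (a * a)) * X I + - (a * a) * Y I))).
  rewrite cexpD !cexpZ.
  have -> : S / (4%:R * (1 + S)) = a * S * (1 - a * (1 + S)).
    by rewrite aE /a; field; lra.
  have a1 : a <= 2%:R^-1 by nra.
  have c0 : 0 <= 2%:R * a - 2%:R * (a * a) by nra.
  have h1 := ler_wpM2l c0 EX.
  have aa : 0 <= a * a by nra.
  have h2 := ler_wpM2l aa EY.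
  lra.
apply: cexp_le => I _.
case: existsP => [_|no].
  have := XX I; have := sqr_ge0 (1 - a * X I); rewrite expr2 => h1 h2.
  have := ler_wpM2l (ltW (mulr_gt0 a0 a0)) h2; rewrite /=; nra.
have X0 : X I = 0.
  rewrite /X big1 // => e ce; case: (boolP (clear e I)) => // he.
  by case: no; exists e; rewrite ce.
have Y0 : 0 <= Y I by apply: sumr_ge0 => e _; apply: sumr_ge0 => f _; rewrite ler0n.
by rewrite X0 mulr0 add0r /= mulNr oppr_le0 mulr_ge0 // ltW ?mulr_gt0.
Qed.

End InstanceClass.

(** * Numerical estimates for a class with few proposals *)

Lemma leq_add_half (a b n : nat) : (a.*2 <= n -> b.*2 <= n -> a + b <= n)%N.
Proof. lia. Qed.

Lemma leq_gap_half (a n : nat) : (a.*2 <= n -> 4 <= n -> n <= 4 * (n - a).-1)%N.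
Proof. lia. Qed.

Section ClassBound.

Local Open Scope ring_scope.

Variables (R : archiRealFieldType) (n : nat) (bp0 gp0 : rankings n) (mu : {perm 'I_n}).
Variable t : R.

Hypothesis mu_best :
  forall g b, in_head gp0 mu g b -> (bp0 b (mu b) <= bp0 b g)%N.
Hypothesis head_sum : \sum_g (head_size gp0 mu g)%:R <= n%:R * t.
Hypothesis t_ge1 : 1 <= t.
Hypothesis n_large : 32%:R * (t + 1) ^+ 2 <= n%:R.

Local Notation w := (weight R gp0 mu).
Local Notation W := (total_weight R gp0 mu).
Local Notation h := (head_size gp0 mu).

Let k g := #|suitors gp0 mu (partner mu g)|.

(** Double counting of the proposals. *)
Lemma suitors_sum : \sum_g (k g)%:R = \sum_g (h g)%:R :> R.
Proof.
rewrite -!natr_sum; congr (_%:R).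
have -> : (\sum_g k g = \sum_b \sum_(g | in_head gp0 mu g b) 1)%N.
  rewrite [RHS](reindex_inj (@perm_inj _ (mu^-1)%g)); apply: eq_bigr => g _.
  by rewrite sum1dep_card.
rewrite (exchange_big_dep xpredT) //=; apply: eq_bigr => g _.
by rewrite sum1dep_card /head_size -card_prefix.
Qed.

Let n_ge128 : 128%:R <= n%:R :> R.
Proof. apply: le_trans n_large; rewrite expr2; have := t_ge1; nra. Qed.

Let w_le g : w g <= 2%:R^-1.
Proof.
rewrite lef_pV2 ?posrE ?ltr0n // ler_nat ltnS; apply/card_gt0P; exists g.
by rewrite inE; exact: in_head_partner.
Qed.

Let w_k g : w g * (k g)%:R <= 1.
Proof. by rewrite mulrC ler_pdivrMr ?ltr0n // mul1r ler_nat. Qed.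

(** Convexity of [1 / x]: the mean of [k g + 1] is at most [t + 1], so the mean weight is at least
    [1 / (t + 1)]. *)
Lemma total_weight_ge : n%:R <= W * (t + 1).
Proof.
have t0 : 0 < t + 1 by have := t_ge1; lra.
(* The tangent of [1 / x] at [x = t + 1] lies below the graph. *)
have tangent g : 2%:R * (t + 1)^-1 - (k g).+1%:R * ((t + 1)^-1) ^+ 2 <= w g.
  set x := (k g).+1%:R; have x0 : 0 < x :> R by rewrite ltr0n.
  have := sqr_ge0 (x * (t + 1)^-1 - 1); rewrite -(pmulr_rge0 _ (weight_gt0 R gp0 mu g)).
  have wx : w g * x = 1 by rewrite mulVf // gt_eqF.
  set y := (t + 1)^-1; move=> h.
  have : w g * (x * y - 1) ^+ 2 = (w g * x) * (x * y ^+ 2) - 2%:R * (w g * x) * y + w g by ring.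
  by move=> e; rewrite e wx in h; lra.
have sumk : \sum_g (k g).+1%:R <= n%:R * (t + 1) :> R.
  rewrite (eq_bigr (fun g => 1 + (k g)%:R)); last by move=> g _; rewrite -addn1 natrD addrC.
  rewrite big_split /= suitors_sum sumr_const card_ord; have := head_sum; lra.
have : \sum_g (2%:R * (t + 1)^-1 - (k g).+1%:R * ((t + 1)^-1) ^+ 2) <= W.
  exact: ler_sum.
rewrite sumrB sumr_const card_ord -mulr_suml => h.
have y0 : 0 < ((t + 1)^-1) ^+ 2 by rewrite exprn_gt0 ?invr_gt0.
have h1 := ler_wpM2r (ltW y0) sumk.
have e1 : n%:R * (t + 1) * (t + 1)^-1 ^+ 2 = n%:R * (t + 1)^-1 by field; lra.
rewrite e1 in h1.
have : n%:R * (t + 1)^-1 <= W.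
  apply: le_trans h; rewrite -[X in _ <= X - _]mulr_natl; lra.
by rewrite ler_pdivrMr.
Qed.

Let t0 : 0 < t + 1.
Proof. have := t_ge1; lra. Qed.

Let W_ge32 : 32%:R * (t + 1) <= W.
Proof.
rewrite -(ler_pM2r t0) -mulrA -expr2; exact: le_trans n_large total_weight_ge.
Qed.

Let W_sqr : 32%:R * n%:R <= W * W.
Proof.
apply: (@le_trans _ _ (32%:R * (W * (t + 1)))).
  by rewrite ler_pM2l ?ltr0n // total_weight_ge.
rewrite mulrCA; apply: ler_wpM2l W_ge32; have := W_ge32; have := t0; lra.
Qed.

Let W_gt0 : 0 < W.
Proof. have := W_ge32; have := t0; lra. Qed.

(** The target window length. After rounding, [L] is at least the ratio, which bounds the number of
    pairs from below, while [beta] contains [L - 1], which is at most the ratio. As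
    [n - h - 1 >= n / 4] for good girls, the constant 16 yields [W * beta <= 1 / 4]. *)
Let ratio : R := n%:R / (16%:R * W).

Let L := (Num.truncn ratio).+1.

Let ratio_ge0 : 0 <= ratio.
Proof. by rewrite divr_ge0 ?ler0n // mulr_ge0 ?ler0n // ltW. Qed.

Let ratio_le : ratio <= (t + 1) / 16%:R.
Proof.
rewrite ler_pdivrMr ?mulr_gt0 ?ltr0n //.
have -> : (t + 1) / 16%:R * (16%:R * W) = W * (t + 1) by field.
exact: total_weight_ge.
Qed.

Let L_ge : ratio <= L%:R.
Proof. by rewrite ltW // truncnS_gt. Qed.

Let L_pred : L.-1%:R <= ratio.
Proof. by rewrite /L /= truncn_le. Qed.

Let L_small : (L.*2 <= n)%N.
Proof.
rewrite -(ler_nat R) -muln2 natrM /L -addn1 natrD.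
have h1 := L_pred; rewrite /L /= in h1.
have := ratio_le; have := n_large; rewrite expr2; have := t_ge1; nra.
Qed.

Let n_ge4 : (4 <= n)%N.
Proof. rewrite -(ler_nat R); have := n_ge128; lra. Qed.

Let good_of g : ((h g).*2 <= n)%N -> good gp0 mu L g.
Proof. by move=> hg; rewrite /good hg !leq_add_half ?L_small ?n_ge4. Qed.

Let good_half g : good gp0 mu L g -> ((h g).*2 <= n)%N.
Proof. by case/and3P. Qed.

Lemma beta_small g : good gp0 mu L g -> W * beta R gp0 mu L g <= 4%:R^-1.
Proof.
move=> /good_half hg; rewrite /beta.
set m := (n - h g).-1; have hm : (n <= 4 * m)%N by exact: leq_gap_half n_ge4.
have hmR : n%:R <= 4%:R * m%:R :> R by rewrite -natrM ler_nat.
have m0 : 0 < m%:R :> R by have := n_ge128; lra.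
rewrite mulrA ler_pdivrMr //.
have h1 := ler_wpM2l (ltW W_gt0) L_pred.
have e : W * ratio = n%:R / 16%:R by rewrite /ratio; field; exact/lt0r_neq0/W_gt0.
rewrite e in h1; lra.
Qed.

(** A girl who is not good has a head longer than [n / 2], so her weight, at most [1 / 2], is below
    [h / n]. *)
Let bad_weight : \sum_(g | ~~ good gp0 mu L g) w g <= t.
Proof.
have bound g : ~~ good gp0 mu L g -> w g <= (h g)%:R / n%:R.
  move=> ng; apply: le_trans (w_le g) _.
  have : (n < (h g).*2)%N by rewrite ltnNge; apply: contra ng; exact: good_of.
  rewrite ler_pdivlMr; last by have := n_ge128; lra.
  by move/ltnW; rewrite -(ler_nat R) -muln2 natrM; lra.
apply: (@le_trans _ _ (\sum_g (h g)%:R / n%:R)).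
  rewrite big_mkcond; apply: ler_sum => g _; case: ifP => [/bound //|_].
  by rewrite divr_ge0 ?ler0n.
rewrite -mulr_suml ler_pdivrMr; last by have := n_ge128; lra.
by rewrite mulrC; exact: head_sum.
Qed.

(** For fixed [c] the sum runs over the [k c] suitors of her partner, and [w c * k c <= 1],
    [w g <= 1 / 2]. *)
Let head_weight :
  \sum_g \sum_c (in_head gp0 mu g (partner mu c))%:R * (w g * w c) <= n%:R / 2%:R.
Proof.
rewrite exchange_big /=; apply: (@le_trans _ _ (\sum_(c < n) 2%:R^-1)).
  apply: ler_sum => c _; apply: (@le_trans _ _ (2%:R^-1 * (w c * (k c)%:R))).
    rewrite /k -sum1dep_card natr_sum !mulr_sumr [leRHS]big_mkcond.
    apply: ler_sum => g _; case: (in_head _ _ _ _); rewrite ?mul0r // mul1r mulr1.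
    by apply: ler_wpM2r (w_le g); exact: weight_ge0.
  by rewrite ler_piMr ?w_k // invr_ge0.
by rewrite sumr_const card_ord -[leLHS]mulr_natl.
Qed.

(** Union bound over the four conditions in [cand]: the excluded pairs weigh at most [2 t W + n],
    which is small against [W * W]. *)
Let cand_weight :
  W * W / 2%:R <= \sum_(e | cand gp0 mu L e) w e.1 * w e.2.
Proof.
pose bad g : R := (~~ good gp0 mu L g)%:R.
pose hd g c : R := (in_head gp0 mu g (partner mu c))%:R.
apply: (@le_trans _ _ (\sum_g \sum_c (w g * w c - bad g * (w g * w c)
    - bad c * (w g * w c) - hd g c * (w g * w c) - hd c g * (w g * w c)))).
  have e1 : \sum_g \sum_c w g * w c = W * W.
    by rewrite /total_weight mulr_suml; apply: eq_bigr => g _; rewrite mulr_sumr.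
  have e2 : \sum_g \sum_c bad g * (w g * w c) <= t * W.
    rewrite (eq_bigr (fun g => bad g * w g * W)); last first.
      by move=> g _; rewrite -!mulr_sumr mulrA.
    rewrite -mulr_suml ler_pM2r //; apply: le_trans bad_weight.
    rewrite [leRHS]big_mkcond; apply: ler_sum => g _.
    by rewrite /bad; case: (good _ _ _ _); rewrite ?mul0r ?mul1r.
  have e3 : \sum_g \sum_c bad c * (w g * w c) <= t * W.
    rewrite exchange_big; apply: le_trans e2; rewrite le_eqVlt; apply/orP; left; apply/eqP.
    by apply: eq_bigr => g _; apply: eq_bigr => c _; rewrite [w c * _]mulrC.
  have e4 : \sum_g \sum_c hd g c * (w g * w c) <= n%:R / 2%:R := head_weight.
  have e5 : \sum_g \sum_c hd c g * (w g * w c) <= n%:R / 2%:R.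
    rewrite exchange_big; apply: le_trans e4; rewrite le_eqVlt; apply/orP; left; apply/eqP.
    by apply: eq_bigr => g _; apply: eq_bigr => c _; rewrite [w c * _]mulrC.
  under eq_bigr do rewrite !sumrB.
  rewrite !sumrB e1.
  have := W_sqr; have := W_ge32; have := W_gt0; have := t0; have := n_ge128; nra.
rewrite pair_big /= [leRHS]big_mkcond; apply: ler_sum => -[g c] _ /=.
have wgc : 0 <= w g * w c by rewrite mulr_ge0 ?weight_ge0.
rewrite /cand /bad /hd /=.
case: (good _ _ _ g); case: (good _ _ _ c); case: (in_head _ _ g _); case: (in_head _ _ c _);
  rewrite /= ?mul0r ?mul1r ?subr0 //; lra.
Qed.

Lemma expected_pairs_ge : 512%:R^-1 <= expected_pairs R gp0 mu L.
Proof.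
have n0 : 0 < n%:R :> R by have := n_ge128; lra.
pose q : R := L%:R / n%:R.
have q0 : 0 <= q by rewrite divr_ge0 ?ler0n.
(* Together with [cand_weight] this gives [(q W) ^ 2 / 2 >= 1 / 512]. *)
have qW : 16%:R^-1 <= q * W.
  rewrite /q mulrAC ler_pdivlMr //.
  have := ler_wpM2r (ltW W_gt0) L_ge.
  have -> : ratio * W = 16%:R^-1 * n%:R by rewrite /ratio; field; exact/lt0r_neq0/W_gt0.
  by [].
have alpha_ge g : good gp0 mu L g -> q <= alpha R gp0 mu L g.
  move=> gg; rewrite /q /alpha; apply: ler_wpM2l; first by rewrite ler0n.
  have gap : (0 < n - h g)%N by case/and3P: gg => _ le2 _; rewrite subn_gt0 (leq_trans _ le2) // addn2 ltnS leqnSn.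
  have nn : (0 < n)%N := ltnW (ltnW (ltnW n_ge4)).
  by rewrite lef_pV2 ?posrE ?ltr0n // ler_nat leq_subr.
apply: (@le_trans _ _ (q * q * \sum_(e | cand gp0 mu L e) w e.1 * w e.2)).
  have := ler_wpM2l (mulr_ge0 q0 q0) cand_weight.
  have := qW; have := W_gt0; nra.
rewrite mulr_sumr; apply: ler_sum => e /and4P[g1 g2 _ _]; rewrite /pair_prob.
apply: ler_wpM2r; first by rewrite mulr_ge0 ?weight_ge0.
by apply: ler_pM => //; exact: alpha_ge.
Qed.

(** The function [s / (4 (1 + s))] is increasing and equals [1 / 2052] at [s = 1 / 512]. *)
Lemma class_clear_prob : exists L0 : nat,
  2052%:R^-1 <= class_prob R bp0 gp0 mu
    (fun I => [exists e, cand gp0 mu L0 e && clear gp0 mu L0 e I]).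
Proof.
exists L; apply: le_trans (prob_some_clear mu_best beta_small).
have := expected_pairs_ge; set S := expected_pairs _ _ _ _ => hS.
by rewrite ler_pdivlMr; [lra | lra].
Qed.

End ClassBound.

(** * Invariance of the conditioning class *)

Lemma inst_classP n (bp0 gp0 : rankings n) mu (I : rankings n * rankings n) : reflect
  ((forall b, I.1 b \in boy_class bp0 gp0 mu b) /\
   (forall g, I.2 g \in girl_class gp0 mu g))
  (I \in inst_class bp0 gp0 mu).
Proof.
rewrite inE !in_set; apply: (iffP andP) => [[/forallP hB /forallP hG]|[hB hG]] //.
by split; apply/forallP.
Qed.

Section ClassInvariance.

Variables (n : nat) (bp0 gp0 : rankings n) (mu : {perm 'I_n}).
Implicit Types (I : rankings n * rankings n) (g b : 'I_n).

(** If [b] preferred [g] to his partner, stability would put him at the very end of her head, which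
    makes him her partner. *)
Lemma stable_mu_best : stable bp0 gp0 mu ->
  forall g b, in_head gp0 mu g b -> bp0 b (mu b) <= bp0 b g.
Proof.
move=> /stableP smu g b hd; rewrite leqNgt; apply/negP => lt.
have le := smu b g lt; have /rank_inj e : gp0 g b = gp0 g ((mu^-1)%g g) :> nat.
  by apply/eqP; rewrite eqn_leq le andbT.
by rewrite e permKV ltnn in lt.
Qed.

Lemma inst_class_id : (bp0, gp0) \in inst_class bp0 gp0 mu.
Proof. by apply/inst_classP; split=> x; [exact: kept_order_id | exact: fixed_head_id]. Qed.

Section Member.

Variable I : rankings n * rankings n.
Hypothesis IC : I \in inst_class bp0 gp0 mu.

Lemma member_head g b : in_head gp0 mu g b -> I.2 g b = gp0 g b.
Proof. by case/inst_classP: IC => _ /(_ g)/fixed_headP; exact. Qed.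

Lemma member_head_size g : head_size I.2 mu g = head_size gp0 mu g.
Proof. by rewrite /head_size member_head // in_head_partner. Qed.

Lemma member_in_head g b : in_head I.2 mu g b = in_head gp0 mu g b.
Proof.
rewrite /in_head member_head_size; case/inst_classP: IC => _ /(_ g) hg.
exact: fixed_head_lt hg.
Qed.

Lemma member_suitors b : suitors I.2 mu b = suitors gp0 mu b.
Proof. by apply/setP => g; rewrite !inE member_in_head. Qed.

Lemma member_order b g g' : in_head gp0 mu g b -> in_head gp0 mu g' b ->
  (I.1 b g < I.1 b g') = (bp0 b g < bp0 b g').
Proof.
by case/inst_classP: IC => /(_ b)/kept_orderP hb _ h h'; apply: hb; rewrite inE.
Qed.

(** Heads, suitors and their order agree for all members, so each member defines the same class. *)
Lemma member_class : inst_class I.1 I.2 mu = inst_class bp0 gp0 mu.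
Proof.
apply/setP => J; apply/inst_classP/inst_classP => -[hB hG]; split=> x.
- apply/kept_orderP => g g' hg hg'; have := hB x; move/kept_orderP => ->.
  + by rewrite inE in hg; rewrite inE in hg'; rewrite member_order.
  + by rewrite member_suitors.
  + by rewrite member_suitors.
- apply/fixed_headP => b hb; have := hG x; move/fixed_headP => ->.
    exact: member_head.
  by rewrite member_head_size member_head.
- apply/kept_orderP => g g'; rewrite member_suitors => hg hg'.
  have := hB x; move/kept_orderP => -> //.
  by rewrite inE in hg; rewrite inE in hg'; rewrite member_order.
- apply/fixed_headP => b; rewrite -/(in_head _ _ _ _) member_in_head => hb.
  by have := hG x; move/fixed_headP => ->; rewrite ?member_head.
Qed.

Lemma member_cost : girl_cost I.2 mu = girl_cost gp0 mu.
Proof. by apply: eq_bigr => g _; exact: member_head_size. Qed.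

(* A stable matching of I that is at least as good as mu for all girls only
   involves proposals made before mu is reached, so it is stable in the
   original instance too. *)
Lemma member_girl_optimal : girl_optimal bp0 gp0 mu -> girl_optimal I.1 I.2 mu.
Proof.
move=> [smu omu]; have best := stable_mu_best smu.
have sI : stable I.1 I.2 mu.
  apply/stableP => b g lt; rewrite leqNgt; apply/negP => lt_g.
  have hd : in_head gp0 mu g b by rewrite -member_in_head; exact: ltnW.
  move: lt; rewrite member_order //; first by rewrite ltnNge best.
  by have := in_head_partner gp0 mu (mu b); rewrite /partner permK.
split=> // nu snu g; have [la sla laE] := stable_join sI snu.
have le_la x : I.2 x ((la^-1)%g x) <= I.2 x ((mu^-1)%g x) by rewrite laE geq_minl.
have hd_la x : in_head gp0 mu x ((la^-1)%g x).
  by rewrite -member_in_head; exact: le_la.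
have sla0 : stable bp0 gp0 la.
  apply/stableP => b x lt; rewrite leqNgt; apply/negP => lt_x.
  have hx : in_head gp0 mu x b by apply: leq_trans (hd_la x); exact: ltnW.
  have hb : in_head gp0 mu (la b) b by have := hd_la (la b); rewrite permK.
  move/stableP: sla => /(_ b x); rewrite member_order // => /(_ lt).
  by rewrite !member_head // leqNgt lt_x.
have := omu la sla0 g.
rewrite -!member_head ?in_head_partner // => /leq_trans; apply.
by rewrite laE geq_minr.
Qed.

End Member.

End ClassInvariance.

(** * From a single class to all instances *)

Section Instances.

Variables (R : realType) (n : nat).
Implicit Types (I : rankings n * rankings n) (mu : {perm 'I_n}).

Definition girl_optimalb I mu := stable I.1 I.2 mu &&
  [forall nu, stable I.1 I.2 nu ==>
     [forall g, I.2 g ((mu^-1)%g g) <= I.2 g ((nu^-1)%g g)]].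

Lemma girl_optimalP I mu : reflect (girl_optimal I.1 I.2 mu) (girl_optimalb I mu).
Proof.
apply: (iffP andP) => [[smu /forall_inP om]|[smu om]]; split=> //.
  by move=> nu snu; apply/forallP; exact: om.
by apply/forall_inP => nu snu; apply/forallP; exact: om.
Qed.

(** The pair [e] is chosen before [F], so that the independent random [F] can afterwards be asked to
    avoid it. *)
Definition swappable I := [exists mu, girl_optimalb I mu &&
  [exists e : 'I_n * 'I_n, (e.1 != e.2) &&
    [forall F : {set 'I_n}, (e.1 \notin F) && (e.2 \notin F) ==>
       ~~ winning_coalition I.1 I.2 F]]].

Local Open Scope ring_scope.

Definition cheap (t : R) I :=
  [exists mu, girl_optimalb I mu && ((girl_cost I.2 mu)%:R <= n%:R * t)].

(** A clear pair satisfies the hypotheses of [swap_not_winning]. A boy whom [g] prefers to her new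
    partner lies either in her head, where [stable_mu_best] applies, or in her window, where
    accepting her would make him a rival. *)
Lemma class_swappable (t : R) I mu : girl_optimal I.1 I.2 mu ->
    (girl_cost I.2 mu)%:R <= n%:R * t -> 1 <= t -> 32%:R * (t + 1) ^+ 2 <= n%:R ->
  2052%:R^-1 * #|inst_class I.1 I.2 mu|%:R
    <= #|[set J in inst_class I.1 I.2 mu | swappable J]|%:R :> R.
Proof.
move=> omu cost t1 tn; have best := stable_mu_best omu.1.
have head_sum : \sum_g (head_size I.2 mu g)%:R <= n%:R * t by rewrite -natr_sum.
have [L pr] := class_clear_prob best head_sum t1 tn.
rewrite -ler_pdivlMr ?inst_class_gt0 //; apply: le_trans pr _.
apply: class_prob_le => J JC /existsP[[g g'] /andP[ce cl]].
have oJ := member_girl_optimal JC omu.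
have ne := cand_neq ce; rewrite /= in ne.
apply/existsP; exists mu; apply/andP; split; first exact/girl_optimalP.
apply/existsP; exists (g, g'); rewrite ne /=.
apply/forall_inP => F /andP[gF g'F].
have [/andP[mut /forallP clr] [good1 good2]] : clear I.2 mu L (g, g') J /\
    (good I.2 mu L g /\ good I.2 mu L g') by case/and4P: ce.
move: mut; rewrite mutualP //= => /andP[/andP[w1 b1] /andP[w2 b2]].
have first_acc x x' : (forall c, c != x -> c != x' -> ~~ rival I.2 mu L x c J) ->
    J.2 x (partner mu x') \in window I.2 mu L x ->
    forall c, (J.2 x c < J.2 x (partner mu x'))%N ->
      (J.1 c (mu c) <= J.1 c x)%N \/ c = partner mu x.
  move=> nor win c lt.
  case: (boolP (in_head J.2 mu x c)) => hd; [left|].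
    exact: stable_mu_best oJ.1 _ _ hd.
  left; have nx : mu c != x.
    by apply: contraNneq hd => <-; rewrite /in_head /head_size /partner permK.
  have nx' : mu c != x'.
    by apply: contraTneq lt => <-; rewrite /partner permK ltnn.
  have win_c : J.2 x c \in window I.2 mu L x.
    rewrite /in_head (member_head_size JC) -leqNgt in hd.
    move: win; rewrite !inE => /andP[_ lt_x']; by rewrite hd (ltn_trans lt lt_x').
  have := nor (mu c) nx nx'; rewrite /rival /partner permK win_c /=.
  by rewrite -leqNgt.
apply: (swap_not_winning oJ ne gF g'F) => //.
  apply: first_acc w1 => c n1 n2.
  by have := clr c; rewrite /= n1 n2 => /andP[].
apply: first_acc w2 => c n1 n2.
by have := clr c; rewrite /= n1 n2 => /andP[].
Qed.

Let cls I : {set rankings n * rankings n} :=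
  if [pick mu | girl_optimalb I mu] is Some mu then inst_class I.1 I.2 mu else set0.

Let clsE I mu : girl_optimal I.1 I.2 mu -> cls I = inst_class I.1 I.2 mu.
Proof.
move=> omu; rewrite /cls; case: pickP => [nu /girl_optimalP onu|/(_ mu)/girl_optimalP //].
by rewrite (girl_optimal_unique onu omu).
Qed.

(** The label [cls] and being cheap are both constant on a class, so the cheap instances form a
    disjoint union of classes and the bounds for single classes add up. *)
Lemma cheap_swappable (t : R) : 1 <= t -> 32%:R * (t + 1) ^+ 2 <= n%:R ->
  2052%:R^-1 * #|[set I | cheap t I]|%:R <= #|[set I | swappable I]|%:R :> R.
Proof.
move=> t1 tn.
have sub : #|[set I in [set I | cheap t I] | swappable I]|%:R
    <= #|[set I | swappable I]|%:R :> R.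
  by rewrite ler_nat; apply: subset_leq_card; apply/subsetP => I; rewrite !inE => /andP[].
apply: le_trans sub; rewrite -sum1_card -sum1dep_card !natr_sum mulr_sumr.
rewrite (partition_big cls xpredT) //= [leRHS](partition_big cls xpredT) //=.
apply: ler_sum => K _.
case: (boolP [exists I, (I \in [set I | cheap t I]) && (cls I == K)]) => [|none]; last first.
  rewrite big_pred0 => [|I]; first by apply: sumr_ge0 => I _; rewrite ler0n.
  by apply/negbTE; move/existsPn: none => /(_ I).
case/existsP=> I0 /andP[]; rewrite inE => /existsP[mu /andP[/girl_optimalP omu cost]] /eqP eK.
rewrite (clsE omu) in eK.
have KE I : (I \in [set I | cheap t I]) && (cls I == K) = (I \in K).
  apply/andP/idP => [[+ /eqP <-]|].
    rewrite inE => /existsP[nu /andP[/girl_optimalP onu _]]; rewrite (clsE onu).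
    by case: I onu => ? ? ?; exact: inst_class_id.
  rewrite -eK => IC; have oI := member_girl_optimal IC omu.
  rewrite (clsE oI) (member_class IC); split=> //; rewrite inE.
  apply/existsP; exists mu; rewrite (member_cost IC) cost andbT; exact/girl_optimalP.
rewrite (eq_bigl _ _ KE) -mulr_sumr.
rewrite (eq_bigl (fun I => (I \in K) && swappable I)); last first.
  by move=> I; rewrite andbAC KE.
rewrite -!natr_sum sum1_card sum1dep_card -eK.
exact: class_swappable omu cost t1 tn.
Qed.

(** Markov's inequality for fixed boys' rankings: the mean cost is at most [n] times the harmonic
    sum, a quarter of the threshold. *)
Lemma cheap_card (t : R) : (0 < n)%N -> 0 < t -> 4%:R * harmonic_sum R n <= t ->
  3%:R / 4%:R * #|{: rankings n * rankings n}|%:R <= #|[set I | cheap t I]|%:R :> R.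
Proof.
move=> n0 t0 tH; pose N : R := #|{: rankings n}|%:R.
have nR : 0 < n%:R :> R by rewrite ltr0n.
have fixed_bp bp : 3%:R / 4%:R * N <= #|[set gp | cheap t (bp, gp)]|%:R :> R.
  have [c [c_stable c_sum]] := @girl_cost_sum n bp (Ordinal n0) R.
  have cheap_c gp : (c gp)%:R <= n%:R * t -> cheap t (bp, gp).
    move=> le; have [nu snu le_nu] := c_stable gp.
    have [mu omu le_mu] := girl_optimal_exists snu.
    apply/existsP; exists mu; apply/andP; split; first exact/(girl_optimalP (bp, gp)).
    by apply: le_trans le; rewrite ler_nat (leq_trans le_mu).
  have markov : (n%:R * t) * #|[set gp | ~~ cheap t (bp, gp)]|%:R <= N * (n%:R * harmonic_sum R n).
    apply: le_trans c_sum; rewrite -sum1dep_card natr_sum mulr_sumr big_mkcond.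
    apply: ler_sum => gp _; case: ifP => [nc|_]; last by rewrite ler0n.
    by rewrite mulr1 ltW // ltNge; apply: contra nc; exact: cheap_c.
  have tot : #|[set gp | cheap t (bp, gp)]|%:R + #|[set gp | ~~ cheap t (bp, gp)]|%:R = N.
    rewrite -natrD /N; congr (_%:R); rewrite -(cardsC [set gp | cheap t (bp, gp)]).
    by congr (_ + _)%N; apply: eq_card => gp; rewrite !inE.
  set x := #|[set gp | ~~ cheap t (bp, gp)]|%:R in markov tot.
  have N0 : 0 <= N by rewrite ler0n.
  have : (n%:R * t) * (4%:R * x) <= (n%:R * t) * N.
    have h1 := ler_wpM2l (mulr_ge0 N0 (ltW nR)) tH; lra.
  by rewrite ler_pM2l ?mulr_gt0 // => h; lra.
have -> : #|[set I | cheap t I]|%:R = \sum_bp #|[set gp | cheap t (bp, gp)]|%:R :> R.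
  rewrite -natr_sum; congr (_%:R); rewrite -sum1dep_card.
  under [in RHS]eq_bigr do rewrite -sum1dep_card.
  by rewrite pair_big_dep; apply: eq_bigl => -[].
have -> : 3%:R / 4%:R * #|{: rankings n * rankings n}|%:R = \sum_(bp : rankings n) (3%:R / 4%:R * N).
  by rewrite sumr_const card_prod natrM -[RHS]mulr_natl /N; ring.
exact: ler_sum.
Qed.

End Instances.

(** * Logarithmic growth of the harmonic sums *)

Local Open Scope ring_scope.

Lemma harmonic_sum_le (R : realFieldType) (m n : nat) : (m <= n)%N ->
  harmonic_sum R m <= harmonic_sum R n.
Proof.
move=> /subnKC <-; rewrite /harmonic_sum big_split_ord /= lerDl.
by apply: sumr_ge0 => i _; rewrite invr_ge0 ler0n.
Qed.

(** Each dyadic block of terms contributes at most 1. *)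
Lemma harmonic_sum_pow2 (R : realFieldType) (k : nat) :
  harmonic_sum R (2 ^ k) <= k.+1%:R.
Proof.
elim: k => [|k IH]; first by rewrite /harmonic_sum big_ord1 invr1.
rewrite expnS mul2n -addnn /harmonic_sum big_split_ord /= -[k.+2]addn1 natrD lerD //.
have p0 : 0 < (2 ^ k)%:R :> R by rewrite ltr0n expn_gt0.
apply: (@le_trans _ _ (\sum_(i < 2 ^ k) ((2 ^ k)%:R)^-1)).
  apply: ler_sum => i _; rewrite lef_pV2 ?posrE ?ltr0n ?expn_gt0 // ler_nat.
  by rewrite -addnS leq_addr.
by rewrite sumr_const card_ord -[leLHS]mulr_natl divff // gt_eqF.
Qed.

Lemma harmonic_small (R : realFieldType) (n : nat) : (2 ^ 20 <= n)%N ->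
  exists2 t : R, 4%:R * harmonic_sum R n <= t & 1 <= t /\ 32%:R * (t + 1) ^+ 2 <= n%:R.
Proof.
move=> hn; have n0 : (0 < n)%N by apply: leq_trans hn; rewrite expn_gt0.
pose j := trunc_log 2 n; have [lo hi] := andP (trunc_log_bounds (isT : 1 < 2)%N n0).
rewrite -/j in lo hi.
have j20 : (20 <= j)%N by apply: trunc_log_max.
(* As [n < 2 ^ (j + 1)], the harmonic sum is at most [j + 2]. *)
exists (4%:R * j.+2%:R).
  rewrite ler_pM2l ?ltr0n //; apply: le_trans (harmonic_sum_pow2 R j.+1).
  exact/harmonic_sum_le/ltnW.
split; first by rewrite -natrM ler1n.
(* Induction from the value at 20, since the quadratic less than doubles at each step. *)
have pow i : (20 <= i)%N -> (32 * ((4 * i.+2 + 1) * (4 * i.+2 + 1)) <= 2 ^ i)%N.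
  elim: i => // i IH; rewrite leq_eqVlt => /orP[/eqP <-|]; first by vm_compute.
  rewrite ltnS => i20; have := IH i20; rewrite expnS; nia.
have -> : 4%:R * j.+2%:R + 1 = (4 * j.+2 + 1)%:R :> R by rewrite natrD natrM.
rewrite expr2 -!natrM ler_nat; exact: leq_trans (pow j j20) lo.
Qed.

(** * Random coalitions and the final count *)

Section Coalitions.

Variables (n k : nat).

Lemma sum_coalition (P : pred {set 'I_n}) :
  (#|[set F : coalition n k | P (val F)]| = #|[set F : {set 'I_n} | P F & #|F| == k]|)%N.
Proof.
rewrite -(card_imset _ val_inj); apply: eq_card => F; rewrite inE.
apply/imsetP/andP => [[G]|[PF kF]]; first by rewrite inE => PG ->; split; rewrite ?(valP G).
by exists (Sub F kF); rewrite ?inE SubK.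
Qed.

Lemma card_coalition : #|coalition n k| = 'C(n, k).
Proof.
have := card_draws 'I_n k; rewrite card_ord => <-; rewrite -cardsT.
have := sum_coalition predT; rewrite (_ : [set F : coalition n k | _] = setT).
  by move=> ->; apply: eq_card => F; rewrite !inE.
by apply/setP => F; rewrite !inE.
Qed.

Lemma card_coalition_avoid (g g' : 'I_n) : g != g' ->
  #|[set F : coalition n k | (g \notin val F) && (g' \notin val F)]| = 'C(n - 2, k).
Proof.
move=> ne; rewrite (sum_coalition (fun F => (g \notin F) && (g' \notin F))).
have -> : (n - 2)%N = #|~: [set g; g']|.
  by rewrite cardsCs setCK cards2 ne card_ord.
rewrite -cards_draws; apply: eq_card => F; rewrite !inE; congr (_ && _).
apply/andP/subsetP => [[gF g'F] x xF|sub].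
  by rewrite !inE negb_or; apply/andP; split; apply: contraTneq xF => ->.
by split; apply/negP => /sub; rewrite !inE eqxx ?orbT.
Qed.

(** The probability [(n - k) (n - 1 - k) / (n (n - 1))] that a random [k]-set avoids two given
    girls, cleared of denominators. *)
Lemma binomial_avoid : (2 <= n)%N ->
  ('C(n - 2, k) * (n * n.-1) = 'C(n, k) * ((n - k) * (n.-1 - k)))%N.
Proof.
case: n => [|[|m]] // _; rewrite subSS subSS subn0 /=.
have := mul_bin_down m.+1 k; have := mul_bin_down m.+2 k => /= e1 e2; nia.
Qed.

End Coalitions.

Lemma Pr_card (R : realType) (n k : nat) (E : pred (outcome n k)) :
  Pr R E = #|[set w | E w]|%:R / (#|{: rankings n * rankings n}|%:R * 'C(n, k)%:R).
Proof.
rewrite /Pr (eq_bigr (fun=> (#|{: rankings n * rankings n}|%:R * 'C(n, k)%:R)^-1)).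
  by rewrite sumr_const -[LHS]mulr_natl cardsE.
move=> w _; rewrite /law /unif !prodr_const card_ord card_coalition invfM.
by rewrite card_prod natrM invfM card_ffun card_ord natrX exprVn.
Qed.

(** The pair of girls varies with the instance, but the number of coalitions avoiding it does
    not. *)
Lemma card_not_winning (n k : nat) :
  (#|[set I : rankings n * rankings n | swappable I]| * 'C(n - 2, k)
    <= #|[set w : outcome n k | not_winning w]|)%N.
Proof.
have -> : (#|[set w : outcome n k | not_winning w]| =
    \sum_(I : rankings n * rankings n) #|[set F : coalition n k | not_winning (I, F)]|)%N.
  rewrite -sum1dep_card; under [RHS]eq_bigr do rewrite -sum1dep_card.
  by rewrite pair_big_dep; apply: eq_bigl => -[].
rewrite -sum_nat_const big_mkcond; apply: leq_sum => I _; rewrite inE.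
case: ifP => // /existsP[mu /andP[_ /existsP[[g g'] /andP[ne /forallP avoid]]]].
rewrite -(card_coalition_avoid k ne); apply: subset_leq_card; apply/subsetP => F.
by rewrite !inE /not_winning => /andP[gF g'F]; have := avoid (val F); rewrite gF g'F.
Qed.

(* Num.truncn is the floor on nonnegative reals. *)
Theorem theorem5p2 (R : realType) (eps : R) (heps : 0 < eps <= 1) :
  exists2 delta : R, 0 < delta &
  exists n0 : nat, forall n : nat, (n0 <= n)%N ->
    delta <= Pr R (@not_winning n (Num.truncn ((1 - eps) * n%:R))).
Proof.
case/andP: heps => eps0 eps1.
(* The bound within cheap classes times the share of cheap instances. *)
pose c : R := 2052%:R^-1 * (3%:R / 4%:R).
(* The first two factors bound the probability that [F] avoids both girls. *)
exists (eps * (eps / 2%:R) * c).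
  by rewrite !mulr_gt0 ?invr_gt0 ?ltr0n.
exists (maxn (2 ^ 20) (Num.truncn (2%:R / eps)).+1) => n.
rewrite geq_max => /andP[n_pow n_eps].
have n2 : (2 <= n)%N by apply: leq_trans n_pow; rewrite (@leq_exp2l 2 1).
have n0 : (0 < n)%N by exact: ltnW.
have nR : 0 < n%:R :> R by rewrite ltr0n.
(* This gives [n - 1 - k >= eps * n - 1 >= eps * n / 2], whence the factor [eps / 2] for the second
   girl. *)
have eps_n : 2%:R <= eps * n%:R.
  rewrite mulrC -ler_pdivrMr //; apply: le_trans (_ : n%:R >= (Num.truncn (2%:R / eps)).+1%:R).
    by rewrite ltW // truncnS_gt.
  by rewrite ler_nat.
set k := Num.truncn _.
have k_le : k%:R <= (1 - eps) * n%:R.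
  by rewrite truncn_le // mulr_ge0 ?ler0n // subr_ge0.
have kn : (k < n)%N by rewrite -(ltr_nat R); have := mulr_gt0 eps0 nR; lra.
have [t tH [t1 tn]] := harmonic_small R n_pow.
have t0 : 0 < t by lra.
rewrite Pr_card; pose N : R := #|{: rankings n * rankings n}|%:R; rewrite -/N.
have N0 : 0 < N.
  by rewrite ltr0n; apply/card_gt0P; exists ([ffun=> 1%g] : rankings n, [ffun=> 1%g] : rankings n).
have C0 : 0 < 'C(n, k)%:R :> R by rewrite ltr0n bin_gt0 ltnW.
rewrite ler_pdivlMr ?mulr_gt0 //.
have swap_many : c * N <= #|[set I : rankings n * rankings n | swappable I]|%:R.
  apply: le_trans (cheap_swappable t1 tn); rewrite /c -mulrA.
  by rewrite ler_pM2l ?invr_gt0 ?ltr0n //; exact: cheap_card.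
have avoid_many : eps * (eps / 2%:R) * 'C(n, k)%:R <= 'C(n - 2, k)%:R.
  have m0 : 0 < n.-1%:R :> R by rewrite ltr0n -ltnS prednK.
  have := congr1 (fun i => i%:R : R) (binomial_avoid k n2).
  rewrite !natrM (natrB _ (ltnW kn)) natrB; last by rewrite -ltnS prednK.
  have nE : n%:R = n.-1%:R + 1 :> R by rewrite -{1}(prednK n0) -addn1 natrD.
  move=> e; have p0 : 0 < n%:R * n.-1%:R :> R by rewrite mulr_gt0.
  rewrite -(ler_pM2r p0) e [leLHS]mulrAC [leLHS]mulrC; apply: ler_wpM2l; first exact: ltW.
  have -> : eps * (eps / 2%:R) * (n%:R * n.-1%:R) = (eps * n%:R) * (eps / 2%:R * n.-1%:R) by ring.
  apply: ler_pM; [lra | | lra | nra].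
  by rewrite !mulr_ge0 ?invr_ge0 ?ler0n // ltW.
have := card_not_winning n k; rewrite -(ler_nat R) natrM; apply: le_trans.
have -> : eps * (eps / 2%:R) * c * (N * 'C(n, k)%:R)
  = (c * N) * (eps * (eps / 2%:R) * 'C(n, k)%:R) by ring.
apply: ler_pM => //; first by rewrite !mulr_ge0 ?invr_ge0 ?ler0n // ltW.
by rewrite !mulr_ge0 ?invr_ge0 ?ler0n // ltW.
Qed.
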